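(* Let $k\in\mathbb N$. Then $M_k(\mathcal M_d)$ acting on $M_k(H^2_d)$ by transposed right multiplication (i.e. through the map $M_k(\mathcal M_d)\to M_{k^2}(\mathcal M_d)$, $F\mapsto F\otimes I_k$) has property $\mathbb A_1(1)$. More precisely, for every weak-$*$ continuous functional $\varphi$ on $M_k(\mathcal M_d)$ with $\|\varphi\|<1$, there exist $s\le k$ and $X,Y\in (H^2_d)^{\oplus ks}$ such that $\|X\|,\|Y\|<1$ and $$\varphi(F)=\langle (F\otimes I_s)X,Y\rangle\qquad\text{for all }F\in M_k(\mathcal M_d).$$ Moreover, $X$ can be chosen to be $M_k(\mathcal M_d)$-cyclic, i.e. $\overline{\{(F\otimes I_s)X: F\in M_k(\mathcal M_d)\}}=(H^2_d)^{\oplus ks}$.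
   Context: $d\in\mathbb N$; $H^2_d$ is the Drury-Arveson space, the reproducing kernel Hilbert space on the unit ball $\mathbb B_d\subset\mathbb C^d$ with kernel $\frac1{1-\langle z,w\rangle}$; $\mathcal M_d\subset B(H^2_d)$ is its multiplier algebra. $M_k(\mathcal M_d)$ carries the operator norm and weak-$*$ topology inherited from $B((H^2_d)^{\oplus k})$. The space $(H^2_d)^{\oplus ks}\cong H^2_d\otimes\mathbb C^k\otimes\mathbb C^s$ is identified with $s\times k$ matrices $X$ over $H^2_d$ (with Hilbert-Schmidt norm), and $F\otimes I_s$ acts by $X\mapsto XF^T$. Property $\mathbb A_1(1)$: a weak-$*$ closed algebra $\mathfrak B\subset B(\mathcal H)$ has property $\mathbb A_1(1)$ (acting on $\mathcal H$) if for every weak-$*$ continuous functional $\varphi$ on $\mathfrak B$ with $\|\varphi\|<1$ there exist $\xi,\eta\in\mathcal H$ with $\|\xi\|,\|\eta\|<1$ and $\varphi(b)=\langle b\xi,\eta\rangle$ for all $b\in\mathfrak B$. *)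

(* Defs.v *)
From HB Require Import structures.
From mathcomp Require Import all_boot all_order all_algebra.
From mathcomp Require Import sesquilinear complex.
From mathcomp Require Import all_classical all_reals all_analysis.

Set Implicit Arguments.
Unset Strict Implicit.
Unset Printing Implicit Defensive.

Import Order.TTheory GRing.Theory Num.Theory Num.Def.
Import numFieldNormedType.Exports.

Local Open Scope classical_set_scope.
Local Open Scope ring_scope.

Definition dotnorm (R : realType) (V : lmodType R[i]) (f : {dot V for conjC})
  (x : V) : R := Num.sqrt (complex.Re (f x x)).

Definition dot_complete (R : realType) (V : lmodType R[i])
    (f : {dot V for conjC}) : Prop :=
  forall u : nat -> V,
    (forall e : R, 0 < e -> exists N : nat, forall m n : nat,
       (N <= m)%N -> (N <= n)%N -> dotnorm f (u m - u n) < e) ->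
    exists l : V, dotnorm f (u n - l) @[n --> \oo] --> (0 : R).

(* The inner product is linear in its first argument. *)
Record hilbert (R : realType) := Hilbert {
  hsort :> lmodType R[i];
  hdot : {dot hsort for conjC};
  hcomplete : dot_complete hdot }.

Definition hnorm (R : realType) (H : hilbert R) (x : H) : R :=
  dotnorm (hdot H) x.

Section DirectSum.
Variables (R : realType) (I : finType) (H : hilbert R).

Definition sumdot (X Y : {ffun I -> H}) : R[i] := \sum_i hdot H (X i) (Y i).

Let sumdotP : bilinear_for (GRing.Scale.Law.clone _ _ *%R _)
  (GRing.Scale.Law.clone _ _ (conjC \; *%R) _) sumdot.
Proof.
split=> [Y a X X' | X a Y Y']; rewrite /sumdot /= mulr_sumr -big_split /=;
  by apply: eq_bigr => i _; rewrite !ffunE ?linearPl ?linearPr.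
Qed.

HB.instance Definition _ := bilinear_isBilinear.Build R[i] {ffun I -> H}
  {ffun I -> H} R[i] *%R (conjC \; *%R) sumdot sumdotP.

Let sumdotC X Y : sumdot X Y = (-1) ^+ false * conjC (sumdot Y X).
Proof.
rewrite mul1r /sumdot rmorph_sum; apply: eq_bigr => i _.
by rewrite hermC expr0 mul1r.
Qed.

HB.instance Definition _ := isHermitianSesquilinear.Build R[i] {ffun I -> H}
  false conjC sumdot sumdotC.

Let sumdot_gt0 X : X != 0 -> 0 < sumdot X X.
Proof.
move=> X0; have [i Xi0] : exists i, X i != 0.
  apply/existsP; apply: contraNT X0; rewrite negb_exists => /forallP h.
  by apply/eqP/ffunP => i; rewrite ffunE; apply/eqP; rewrite -[_ == _]negbK h.
rewrite /sumdot (bigD1 i) //= ltr_wpDr ?dnorm_gt0 //.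
by apply: sumr_ge0 => j _; exact: dnorm_ge0.
Qed.

HB.instance Definition _ :=
  isDotProduct.Build R[i] {ffun I -> H} sumdot sumdot_gt0.

Let sdot : {dot {ffun I -> H} for conjC} := sumdot.

Let dotnorm_sqr (V : lmodType R[i]) (f : {dot V for conjC}) x :
  dotnorm f x ^+ 2 = complex.Re (f x x).
Proof. by rewrite sqr_sqrtr // -(@lecR R) RRe_real ?ger0_real ?dnorm_ge0. Qed.

Let sumnorm X : dotnorm sdot X = Num.sqrt (\sum_i dotnorm (hdot H) (X i) ^+ 2).
Proof.
rewrite /dotnorm; congr Num.sqrt; rewrite /= /sumdot raddf_sum /=.
by apply: eq_bigr => i _; rewrite dotnorm_sqr.
Qed.

Let cvg_sum0 (f : I -> nat -> R) : (forall i, f i n @[n --> \oo] --> (0 : R)) ->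
  \sum_i f i n @[n --> \oo] --> (0 : R).
Proof.
move=> f0; elim: (index_enum I) => [|i r IHr].
  by under eq_cvg do rewrite big_nil; exact: cvg_cst.
under eq_cvg do rewrite big_cons.
by have := cvgD (f0 i) IHr; rewrite addr0; exact.
Qed.

Lemma sumdot_complete : dot_complete sdot.
Proof.
move=> u uC.
have /choice[l lP] : forall i, exists l : H,
    dotnorm (hdot H) (u n i - l) @[n --> \oo] --> (0 : R).
  move=> i; apply: (@hcomplete R H (fun n => u n i)) => e /uC[N uN].
  exists N => m n Nm Nn; apply: le_lt_trans (uN m n Nm Nn).
  rewrite sumnorm -[leLHS]ger0_norm ?sqrtr_ge0 // -sqrtr_sqr ler_wsqrtr //.
  rewrite (bigD1 i) //= !ffunE lerDl.
  by apply: sumr_ge0 => j _; exact: sqr_ge0.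
exists [ffun i => l i].
have S0 : \sum_i dotnorm (hdot H) (u n i - l i) ^+ 2 @[n --> \oo] --> (0 : R).
  by apply: cvg_sum0 => i; have := cvgM (lP i) (lP i); rewrite mulr0; exact.
have := continuous_cvg _ (@sqrt_continuous R 0) S0; rewrite sqrtr0.
under [X in _ -> X]eq_cvg => n.
  rewrite sumnorm; under eq_bigr => i _ do rewrite !ffunE; over.
exact.
Qed.

Definition hsum : hilbert R := Hilbert sumdot_complete.

End DirectSum.

Section Operators.
Variables (R : realType) (H : hilbert R).

Definition opnorm (T : H -> H) : \bar R :=
  ereal_sup [set (hnorm (T x))%:E | x in [set x : H | hnorm x <= 1]].

Definition bounded_op : set (H -> H) :=
  [set T | linear T /\ (opnorm T < +oo)%E].

Definition square_summable (x : nat -> H) : Prop :=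
  (\sum_(0 <= n <oo) (hnorm (x n) ^+ 2)%:E < +oo)%E.

Definition l2seq := {x : nat -> H | square_summable x}.

(* The functional T |-> tr (T A) for the trace class operator A that is the
   sum of the rank one operators <., y_n> x_n; the series converges for
   bounded T, and every trace class operator arises in this way. *)
Definition trace_pairing (p : l2seq * l2seq) (T : H -> H) : (R[i])^o :=
  limn (series (fun n => hdot H (T (sval p.1 n)) (sval p.2 n) : (R[i])^o)).

(* The weak-* topology of B(H), as the dual of the trace class operators.  It is
   put on all maps H -> H, but only its trace on subsets of bounded_op is used. *)
Definition weakstar : topologicalType :=
  sup_topology (fun p => Topological.class (initial_topology (trace_pairing p))).

Variable B : set (H -> H).

Definition weakstar_functional (phi : (H -> H) -> R[i]) : Prop :=
  (forall (a : R[i]) (S T : H -> H), B S -> B T ->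
     phi (a *: S + T) = a * phi S + phi T) /\
  {within (B : set weakstar), continuous (phi : weakstar -> (R[i])^o)}.

Definition functional_norm (phi : (H -> H) -> R[i]) : \bar R :=
  ereal_sup [set (Normc.normc (phi T))%:E | T in B `&` [set T | (opnorm T <= 1)%E]].

Definition property_A1_1 : Prop :=
  forall phi : (H -> H) -> R[i],
    weakstar_functional phi -> (functional_norm phi < 1)%E ->
    exists xi eta : H, [/\ hnorm xi < 1, hnorm eta < 1 &
      forall T, B T -> phi T = hdot H (T xi) eta].

End Operators.

(* A Hilbert space of functions on Z (through the injection reval) in which the
   functions K(., w) reproduce point evaluation at w; K determines it uniquely. *)
Record rkhs (R : realType) (Z : Type) (K : Z -> Z -> R[i]) := Rkhs {
  rspace :> hilbert R;
  reval : rspace -> Z -> R[i];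
  reval_linear : forall (a : R[i]) (f g : rspace) (z : Z),
    reval (a *: f + g) z = a * reval f z + reval g z;
  reval_inj : injective reval;
  rkernel : Z -> rspace;
  rkernelE : forall z w : Z, reval (rkernel w) z = K z w;
  reproducing : forall (f : rspace) (w : Z),
    reval f w = hdot rspace f (rkernel w) }.

(* The operators f |-> u f on H; their boundedness is automatic by the closed
   graph theorem. *)
Definition multiplier_algebra (R : realType) (Z : Type) (K : Z -> Z -> R[i])
    (H : rkhs K) : set (H -> H) :=
  [set T | bounded_op T /\
     exists u : Z -> R[i], forall f z, reval (T f) z = u z * reval f z].

Section DruryArveson.
Variables (R : realType) (d : nat).

Definition unit_ball : Type :=
  {z : 'rV[R[i]]_d | \sum_j `|z 0 j| ^+ 2 < 1}.

Definition da_kernel (z w : unit_ball) : R[i] :=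
  (1 - \sum_j sval z 0 j * (sval w 0 j)^*)^-1.

Definition drury_arveson := rkhs da_kernel.

End DruryArveson.

Section MatrixAction.
Variables (R : realType) (H : hilbert R) (k : nat).

Definition colaction (F : 'M[H -> H]_k) (x : hsum 'I_k H) : hsum 'I_k H :=
  [ffun i => \sum_j F i j (x j)].

(* F (x) I_s, i.e. X |-> X F^T on s x k matrices X over H. *)
Definition tensor_id (s : nat) (F : 'M[H -> H]_k)
    (X : hsum ('I_s * 'I_k)%type H) : hsum ('I_s * 'I_k)%type H :=
  [ffun p => \sum_l F p.2 l (X (p.1, l))].

End MatrixAction.

Section MatrixMultipliers.
Variables (R : realType) (Z : Type) (K : Z -> Z -> R[i]) (H : rkhs K) (k : nat).

Definition matrix_multipliers : set 'M[H -> H]_k :=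
  [set F | forall i j, multiplier_algebra (F i j)].

(* M_k of the multiplier algebra as a subset of B(H^k), and its image in
   B(H^(s k)) under F |-> F (x) I_s. *)
Definition multiplier_ops : set (hsum 'I_k H -> hsum 'I_k H) :=
  [set colaction F | F in matrix_multipliers].

Definition amplified_ops (s : nat) :
    set (hsum ('I_s * 'I_k)%type H -> hsum ('I_s * 'I_k)%type H) :=
  [set tensor_id F | F in matrix_multipliers].

Definition cyclic_vector (s : nat) (X : hsum ('I_s * 'I_k)%type H) : Prop :=
  forall (Y : hsum ('I_s * 'I_k)%type H) (e : R), 0 < e ->
    exists2 F, matrix_multipliers F & hnorm (tensor_id F X - Y) < e.

End MatrixMultipliers.

Arguments multiplier_algebra {R Z K} H _.
Arguments matrix_multipliers {R Z K} H k _.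
Arguments multiplier_ops {R Z K} H k _.
Arguments amplified_ops {R Z K} H k s _.

(* Main.v *)
Require Import Defs.
From HB Require Import structures.
From mathcomp Require Import all_boot all_order all_algebra.
From mathcomp Require Import sesquilinear complex.
From mathcomp Require Import all_classical all_reals all_analysis.
From mathcomp Require Import ring lra.
Set Implicit Arguments.
Unset Strict Implicit.
Unset Printing Implicit Defensive.
Import Order.TTheory GRing.Theory Num.Theory Num.Def.
Import numFieldNormedType.Exports.
Local Open Scope classical_set_scope.
Local Open Scope ring_scope.
Local Open Scope complex_scope.

(** A weak-star continuous functional on the matrix multipliers is
    [F |-> '[F x, y]] for sequences [x] and [y] in the column space over [H]. The
    proof first makes the norms of [x] and [y] less than [1], and then replaces
    the infinite multiplicity by a multiplicity [s <= k].

    Norms. Let [q] be the least cost [(n2 x + n2 y) / 2] of a representation of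
    a functional. A Hahn-Banach functional below [q] is given by a contraction
    [T], through its values on rank one functionals; [T] is again a matrix
    multiplier, because matrix multipliers are defined by the equations
    [(M h)(z) = h(z) (M 1)(z)], which are annihilation by finite rank
    functionals. So [q phi] is at most the norm of [phi] ([norming_operator],
    [predual_norm]).

    Multiplicity. The kernel [1 / (1 - <z, w>)] says that the adjoints [T i] of
    the coordinate multipliers satisfy [1 = P + \sum_i (T i)^* (T i)] with [P] the
    projection on the constants ([backward_shift]). Hence [H], and the space
    [l2 H] of sequences over it, embed isometrically in full Fock spaces, and the
    [T i] become backward shifts ([coext_isometry]). In the Fock space over
    [l2 H] the invariant subspace generated by the [k] columns [x j] is the
    orthogonal sum of the translates of its wandering space, which has dimension
    [s <= k]: the shifts are isometries with orthogonal ranges, which the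
    coordinate multipliers on [H] are not in several variables. The coefficients with respect to a
    basis of the wandering space define a map that commutes with the backward
    shifts. On a reproducing kernel, a joint eigenvector of the backward shifts,
    it has to give reproducing kernels for the same point; therefore it leaves
    the image of [l2 H] invariant, and restricts to a contraction [Th] from
    sequences to sequences of length [s]. The coefficient map is isometric on the
    invariant subspace, which gives [phi F = '[(F (x) I_s) X, Y]] for [X = Th x] and
    [Y = Th y], and also the cyclicity of [X] ([inner_factor]).

    If [phi] vanishes, [x] is chosen nonzero and [y = 0], so that [s] is
    positive. *)

Local Notation "''[' x , y ]" := (hdot _ x y) : ring_scope.
Local Notation normc := Normc.normc.
(* Simplification would unfold the inner products of direct sums. *)
Arguments hdot : simpl never.
Arguments sesquilinear.Dot.sort : simpl never.

(** * Complex moduli and inner products *)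

Section ComplexModulus.
Variable R : realType.
Implicit Types (a b : R[i]) (t : R).

Lemma normcC a : (normc a)%:C = `|a|. Proof. by []. Qed.
Lemma normc_conj a : normc (a^* )%R = normc a.
Proof. by have := norm_conjC a; rewrite -!normcC => -[]. Qed.
Lemma normcN a : normc (- a) = normc a.
Proof. by have := normrN a; rewrite -!normcC => -[]. Qed.
Lemma normc_ge0 a : 0 <= normc a.
Proof. by rewrite -lecR normcC normr_ge0. Qed.
Lemma Re_le_normc a : complex.Re a <= normc a.
Proof.
apply: le_trans (ler_norm _) _; rewrite -lecR; exact: normc_ge_Re.
Qed.
Lemma normcR t : normc t%:C = `|t|.
Proof. by rewrite /= expr0n /= addr0 sqrtr_sqr. Qed.
Lemma normc_sqr a : (normc a ^+ 2)%:C = a * (a^* )%R.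
Proof. by rewrite rmorphXn /= normcC normCK. Qed.
End ComplexModulus.

Section HilbertBasics.
Variables (R : realType) (H : hilbert R).
Implicit Types (x y z : H) (a : R[i]).

Definition n2 x : R := complex.Re '[x, x].

Lemma dotC x y : '[x, y] = ('[y, x]^* )%R.
Proof. by rewrite (hermC (hdot H)) expr0 mul1r. Qed.
Lemma dotDl x y z : '[x + y, z] = '[x, z] + '[y, z]. Proof. exact: linearDl. Qed.
Lemma dotDr x y z : '[z, x + y] = '[z, x] + '[z, y]. Proof. exact: linearDr. Qed.
Lemma dotNl x z : '[- x, z] = - '[x, z]. Proof. exact: linearNl. Qed.
Lemma dotNr x z : '[z, - x] = - '[z, x]. Proof. exact: linearNr. Qed.
Lemma dotBl x y z : '[x - y, z] = '[x, z] - '[y, z]. Proof. exact: linearBl. Qed.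
Lemma dotBr x y z : '[z, x - y] = '[z, x] - '[z, y]. Proof. exact: linearBr. Qed.
Lemma dotZl a x z : '[a *: x, z] = a * '[x, z]. Proof. exact: linearZl_LR. Qed.
Lemma dotZr a x z : '[z, a *: x] = (a^* )%R * '[z, x].
Proof. by rewrite [LHS]dotC dotZl rmorphM [in RHS]dotC. Qed.
Lemma dot0l z : '[0, z] = 0 :> R[i]. Proof. exact: linear0l. Qed.
Lemma dot0r z : '[z, 0] = 0. Proof. exact: linear0r. Qed.
Lemma dot_suml I r (P : pred I) (F : I -> H) z :
  '[\sum_(i <- r | P i) F i, z] = \sum_(i <- r | P i) '[F i, z].
Proof. exact: linear_sumlz. Qed.
Lemma dot_sumr I r (P : pred I) (F : I -> H) z :
  '[z, \sum_(i <- r | P i) F i] = \sum_(i <- r | P i) '[z, F i].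
Proof. exact: linear_sumr. Qed.
Lemma dotxx x : '[x, x] = (n2 x)%:C.
Proof. by rewrite RRe_real // ger0_real // dnorm_ge0. Qed.
Lemma n2_ge0 x : 0 <= n2 x.
Proof. by rewrite -ler0c -dotxx dnorm_ge0. Qed.
Lemma n2_eq0 x : n2 x = 0 -> x = 0.
Proof. by move=> h; apply/eqP; rewrite -(dnorm_eq0 (hdot H)) dotxx h. Qed.
Lemma n20 : n2 0 = 0. Proof. by rewrite /n2 dot0l. Qed.
Lemma n2E x : hnorm x ^+ 2 = n2 x.
Proof. by rewrite sqr_sqrtr // n2_ge0. Qed.
Lemma hnorm_ge0 x : 0 <= hnorm x. Proof. exact: sqrtr_ge0. Qed.
Lemma n2Z a x : n2 (a *: x) = normc a ^+ 2 * n2 x.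
Proof.
have := dotxx (a *: x); rewrite dotZl dotZr mulrA -normc_sqr dotxx.
by rewrite -rmorphM => -[].
Qed.
Lemma n2N x : n2 (- x) = n2 x.
Proof. by rewrite /n2 dotNl dotNr opprK. Qed.
Lemma ReC x y : complex.Re '[x, y] = complex.Re '[y, x].
Proof. by rewrite dotC; case: '[y, x]. Qed.
Lemma n2D x y : n2 (x + y) = n2 x + n2 y + 2 * complex.Re '[x, y].
Proof.
rewrite /n2 dotDl !dotDr !raddfD /= [complex.Re '[y, x]]ReC; ring.
Qed.
Lemma n2B x y : n2 (x - y) = n2 x + n2 y - 2 * complex.Re '[x, y].
Proof. by rewrite n2D n2N dotNr raddfN /= mulrN. Qed.
Lemma cauchy_schwarz x y : normc '[x, y] ^+ 2 <= n2 x * n2 y.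
Proof.
have [y0|y0] := eqVneq y 0.
  by rewrite y0 dot0r n20 mulr0 Normc.normc0 expr0n.
have ny : n2 y != 0 by apply: contra_neq y0; exact: n2_eq0.
have nyp : 0 < n2 y by rewrite lt_def ny n2_ge0.
pose a := '[x, y] / (n2 y)%:C.
have := n2_ge0 (x - a *: y).
rewrite n2B n2Z dotZr.
have -> : normc a ^+ 2 * n2 y = normc '[x, y] ^+ 2 / n2 y.
  rewrite /a Normc.normcM Normc.normcV normcR (ger0_norm (n2_ge0 y)) exprMn; field.
  by [].
have -> : (a^* )%R * '[x, y] = (normc '[x, y] ^+ 2 / n2 y)%:C.
  have -> : (a^* )%R = ('[x, y]^* )%R / (n2 y)%:C.
    rewrite /a rmorphM fmorphV; congr (_ / _); exact: conjc_real.
  by rewrite mulrAC [X in X / _]mulrC -normc_sqr -fmorphV -rmorphM.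
rewrite /= -ler_pdivrMr //; lra.
Qed.
Lemma cauchy_schwarz_norm x y : normc '[x, y] <= hnorm x * hnorm y.
Proof.
rewrite -(@ler_pXn2r _ 2) ?nnegrE ?normc_ge0 ?mulr_ge0 ?hnorm_ge0 //.
by rewrite exprMn !n2E cauchy_schwarz.
Qed.
Lemma hnorm_eq0 x : hnorm x = 0 -> x = 0.
Proof. by move=> h; apply: n2_eq0; rewrite -n2E h expr0n. Qed.
Lemma hnorm0 : hnorm (0 : H) = 0.
Proof. by rewrite /hnorm /dotnorm dot0l sqrtr0. Qed.
Lemma hnorm_triangle x y : hnorm (x + y) <= hnorm x + hnorm y.
Proof.
rewrite -(@ler_pXn2r _ 2) ?nnegrE ?addr_ge0 ?hnorm_ge0 //.
rewrite sqrrD !n2E n2D; have := cauchy_schwarz_norm x y.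
have := Re_le_normc '[x, y]; lra.
Qed.
Lemma hnorm_opp x : hnorm (- x) = hnorm x.
Proof. by rewrite /hnorm /dotnorm dotNl dotNr opprK. Qed.
Lemma hnormZ a x : hnorm (a *: x) = normc a * hnorm x.
Proof.
apply/eqP; rewrite -(@eqrXn2 _ 2) ?mulr_ge0 ?hnorm_ge0 ?normc_ge0 //.
by rewrite exprMn !n2E n2Z.
Qed.
Lemma hnormB_C x y : hnorm (x - y) = hnorm (y - x).
Proof. by rewrite -hnorm_opp opprB. Qed.
Lemma hnormB_tri x y z : hnorm (x - z) <= hnorm (x - y) + hnorm (y - z).
Proof. by apply: le_trans (hnorm_triangle _ _); rewrite addrA subrK. Qed.
Lemma dot_ext x y : (forall z, '[x, z] = '[y, z]) -> x = y.
Proof.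
move=> h; apply/eqP; rewrite -subr_eq0; apply/eqP/n2_eq0.
by rewrite /n2 dotBl h subrr.
Qed.
Lemma hnorm_lt1 x : (hnorm x < 1) = (n2 x < 1).
Proof. by rewrite -n2E expr_lt1 // hnorm_ge0. Qed.
End HilbertBasics.

Lemma hnorm_le (R : realType) (G K : hilbert R) (x : G) (y : K) :
  (hnorm x <= hnorm y) = (n2 x <= n2 y).
Proof. by rewrite -!n2E ler_pXn2r ?nnegrE ?hnorm_ge0. Qed.

(** * Projections and the Riesz representation *)

Section Projection.
Variables (R : realType) (H : hilbert R).
Implicit Types (x y z : H) (a : R[i]).

Lemma cvg0_eventually (u : nat -> R) (e : R) :
  u n @[n --> \oo] --> (0 : R) -> 0 < e ->
  exists N, forall n, (N <= n)%N -> `|u n| < e.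
Proof.
move=> /cvgr0Pnorm_lt h e0; have [N _ hN] := h e e0.
by exists N => n Nn; exact: hN.
Qed.

Definition is_subspace (A : set H) :=
  A 0 /\ forall a x y, A x -> A y -> A (a *: x + y).

(** First variation: take [a = '[z, x] / n2 x]. *)
Lemma minimizer_orth x z : (forall a, n2 z <= n2 (z - a *: x)) -> '[z, x] = 0.
Proof.
move=> h; have [->|x0] := eqVneq x 0; first exact: dot0r.
have nx : 0 < n2 x.
  by rewrite lt_def n2_ge0 andbT; apply: contra_neq x0; exact: n2_eq0.
have := h ('[z, x] / (n2 x)%:C); rewrite n2B n2Z dotZr.
have -> : ((('[z, x] / (n2 x)%:C)^* )%R * '[z, x]) = (normc '[z, x] ^+ 2 / n2 x)%:C.
  rewrite rmorphM fmorphV [X in _ / X](conjc_real (n2 x)).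
  by rewrite mulrAC [X in X / _]mulrC -normc_sqr -fmorphV -rmorphM.
rewrite Normc.normcM Normc.normcV normcR (ger0_norm (n2_ge0 x)) exprMn /=.
set c := normc _.
have -> : c ^+ 2 * (n2 x)^-1 ^+ 2 * n2 x = c ^+ 2 / n2 x.
  by field; rewrite gt_eqF.
move=> h1; have : c ^+ 2 / n2 x <= 0 by lra.
rewrite pmulr_lle0 ?invr_gt0 // => h2.
apply: Normc.eq0_normc; apply/eqP; rewrite -sqrf_eq0 -/c eq_le h2.
exact: sqr_ge0.
Qed.

(** A minimizing sequence for the distance from [x] to [A] is Cauchy by the
    parallelogram law. The closure of [A] is not formed: the second conclusion
    says that [p] lies in it. *)
Lemma projection (A : set H) x : is_subspace A -> exists p : H,
  (forall y, A y -> '[x - p, y] = 0) /\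
  (forall e : R, 0 < e -> exists2 y, A y & hnorm (y - p) < e).
Proof.
move=> [A0 AL].
pose D : set R := [set hnorm (x - y) | y in A].
have Dinf : has_inf D.
  split; first by exists (hnorm (x - 0)), 0.
  by exists 0 => _ [y _ <-]; exact: hnorm_ge0.
pose d := inf D.
have d0 : 0 <= d by apply: lb_le_inf => [|_ [y _ <-]]; [exact: Dinf.1|exact: hnorm_ge0].
have dle y : A y -> d <= hnorm (x - y).
  by move=> Ay; apply: ge_inf; [exact: Dinf.2|exists y].
have /choice[u uP] : forall n, exists y, A y /\ hnorm (x - y) < d + n.+1%:R^-1.
  move=> n; have e0 : 0 < (n.+1%:R^-1 : R) by rewrite invr_gt0 ltr0n.
  by have [_ [y Ay <-] hy] := inf_adherent e0 Dinf; exists y.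
(* parallelogram law for [x - u m] and [x - u n] *)
have key m n (e : R) : (0 < e) -> hnorm (x - u m) < d + e -> hnorm (x - u n) < d + e ->
    n2 (u m - u n) <= 8 * d * e + 4 * e ^+ 2.
  move=> e0 hm hn.
  have h : n2 (u m - u n) = 2 * n2 (x - u m) + 2 * n2 (x - u n) -
     4 * n2 (x - (2^-1)%:C *: (u m + u n)).
    have -> : u m - u n = (x - u n) - (x - u m) by rewrite opprB [RHS]addrC addrA subrK.
    have -> : x - (2^-1)%:C *: (u m + u n) = (2^-1)%:C *: ((x - u n) + (x - u m)).
      rewrite addrACA -opprD scalerBr; congr (_ - _); last by rewrite addrC.
      rewrite (_ : x + x = (2 : R)%:C *: x); last first.
        by rewrite (_ : (2 : R)%:C = 1 + 1) ?scalerDl ?scale1r // -rmorphD.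
      by rewrite scalerA -rmorphM /= mulVf ?scale1r.
    rewrite n2Z normcR [LHS]n2B [n2 (_ + (_ - _))]n2D ger0_norm ?invr_ge0 //; by field.
  have h3 : d ^+ 2 <= n2 (x - (2^-1)%:C *: (u m + u n)).
    rewrite -n2E ler_pXn2r ?nnegrE ?hnorm_ge0 //; apply: dle.
    have [um _] := uP m; have [un _] := uP n.
    have := AL (2^-1)%:C (u m + u n) 0; rewrite addr0; apply => //.
    by have := AL 1 (u m) (u n); rewrite scale1r; apply.
  have sq z : hnorm z < d + e -> n2 z <= (d + e) ^+ 2.
    by move=> hz; rewrite -n2E ler_pXn2r ?nnegrE ?hnorm_ge0 ?addr_ge0 // ltW.
  rewrite h; have := sq _ hm; have := sq _ hn; lra.
have small n (e : R) : 0 < e -> (Num.truncn e^-1 < n)%N -> hnorm (x - u n) < d + e.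
  move=> e0 hn; apply: lt_le_trans (proj2 (uP n)) _; rewrite lerD2l.
  rewrite -[leRHS]invrK lef_pV2 ?posrE ?invr_gt0 ?ltr0n //.
  apply: le_trans (ltW (truncnS_gt _)) _; rewrite ler_nat.
  exact: leq_trans hn _.
have [l ul] : exists l, dotnorm (hdot H) (u n - l) @[n --> \oo] --> (0 : R).
  apply: (@hcomplete R H) => e e0.
  pose f := Num.min 1 (e ^+ 2 / (2 * (8 * d + 4))).
  have dd : 0 < 2 * (8 * d + 4) by lra.
  have f0 : 0 < f by rewrite lt_min ltr01 /= divr_gt0 // exprn_gt0.
  exists (Num.truncn f^-1).+1 => m n hm hn.
  have := key m n f f0 (small _ _ f0 hm) (small _ _ f0 hn).
  rewrite -n2E => h; rewrite -(@ltr_pXn2r _ 2) ?nnegrE ?hnorm_ge0 ?ltW //.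
  apply: le_lt_trans h _.
  have f1 : f <= 1 by rewrite ge_min lexx.
  have fe : f * (2 * (8 * d + 4)) <= e ^+ 2.
    by rewrite -ler_pdivlMr // ge_min lexx orbT.
  have : 0 < e ^+ 2 by rewrite exprn_gt0.
  have : f ^+ 2 <= f by rewrite expr2 ger_pMr.
  lra.
have uln (e : R) : 0 < e -> exists n, hnorm (u n - l) < e /\ hnorm (x - u n) < d + e.
  move=> e0; have [N hN] := cvg0_eventually ul e0.
  exists (maxn N (Num.truncn e^-1).+1); split.
    have := hN _ (leq_maxl N (Num.truncn e^-1).+1).
    by rewrite ger0_norm ?hnorm_ge0.
  by apply: small => //; exact: leq_maxr.
have ld : hnorm (x - l) <= d.
  apply/ler_addgt0Pr => e e0; have e2 : 0 < e / 2 by lra.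
  have [n [h1 h2]] := uln _ e2; have := hnormB_tri x (u n) l; lra.
have ldy y : A y -> d <= hnorm (x - l - y).
  move=> Ay; apply/ler_addgt0Pr => e e0.
  have [n [h1 _]] := uln _ e0; have [un _] := uP n.
  have Auy : A (u n + y) by have := AL 1 (u n) y; rewrite scale1r; apply.
  have := dle _ Auy; have := hnormB_tri x (l + y) (u n + y).
  have -> : l + y - (u n + y) = l - u n by rewrite opprD addrACA subrr addr0.
  by rewrite (hnormB_C l) -[x - l - y]addrA -opprD; lra.
exists l; split; last first.
  by move=> e e0; have [n [h1 _]] := uln _ e0; exists (u n) => //; exact: (uP n).1.
move=> y Ay; apply: minimizer_orth => a; rewrite -hnorm_le.
apply: le_trans ld _; apply: ldy.
by have := AL a y 0; rewrite addr0; apply.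
Qed.

(** Closed subspaces are used below in the form of double orthogonal
    complements; this is the projection on such a complement. *)
Lemma perp_decomp (S : set H) x : exists p : H,
  (forall y, (forall s, S s -> '[y, s] = 0) -> '[p, y] = 0) /\
  (forall s, S s -> '[x - p, s] = 0).
Proof.
pose A : set H := [set y | forall s, S s -> '[y, s] = 0].
have AL : is_subspace A.
  split=> [s _|a y z Ay Az s Ss]; first exact: dot0l.
  by rewrite dotDl dotZl Ay // Az // mulr0 addr0.
have [q [xq qA]] := projection x AL.
exists (x - q); split=> [y Ay|s Ss]; first exact: xq.
rewrite opprB addrC subrK; apply: Normc.eq0_normc.
apply/eqP; rewrite eq_le normc_ge0 andbT; apply/ler_addgt0Pr => e e0; rewrite add0r.
have e1 : 0 < e / (hnorm s + 1) by rewrite divr_gt0 // ltr_wpDl ?hnorm_ge0.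
have [y Ay hy] := qA _ e1.
have -> : '[q, s] = - '[y - q, s] by rewrite dotBl Ay // sub0r opprK.
rewrite normcN; apply: le_trans (cauchy_schwarz_norm _ _) _.
have s1 : 0 < hnorm s + 1 by rewrite ltr_wpDl ?hnorm_ge0.
apply: le_trans (_ : e / (hnorm s + 1) * (hnorm s + 1) <= _).
  by apply: ler_pM; rewrite ?hnorm_ge0 ?lerDl // ltW.
by rewrite divfK ?gt_eqF.
Qed.

(** The vector is a multiple of a normal [z] to the kernel of [f]. *)
Lemma riesz (f : H -> R[i]) (C : R) :
  (forall a x y, f (a *: x + y) = a * f x + f y) ->
  (forall x, normc (f x) <= C * hnorm x) -> exists y, forall x, f x = '[x, y].
Proof.
move=> fL fC.
have f0 : f 0 = 0 by have := fL (-1) 0 0; rewrite scaler0 addr0 mulN1r addNr.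
have fZ a x : f (a *: x) = a * f x by have := fL a x 0; rewrite f0 !addr0.
have fB x y : f (x - y) = f x - f y.
  by rewrite -scaleN1r addrC fL mulN1r addrC.
have [h|] := pselect (forall x, f x = 0).
  by exists 0 => x; rewrite h dot0r.
move=> /existsNP[x0 /eqP fx0].
pose A : set H := [set x | f x = 0].
have AL : is_subspace A.
  by split=> // a x y Ax Ay; rewrite /A /= fL Ax Ay mulr0 addr0.
have [p [xp pA]] := projection x0 AL.
have fp : f p = 0.
  apply: Normc.eq0_normc.
  apply/eqP; rewrite eq_le normc_ge0 andbT; apply/ler_addgt0Pr => e e0.
  rewrite add0r.
  have C0 : 0 < `|C| + 1 by rewrite ltr_wpDl.
  have e1 : 0 < e / (`|C| + 1) by rewrite divr_gt0.
  have [y Ay hy] := pA _ e1.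
  have -> : f p = - f (y - p) by rewrite fB Ay sub0r opprK.
  rewrite normcN; apply: le_trans (fC _) _.
  apply: le_trans (_ : (`|C| + 1) * (e / (`|C| + 1)) <= _).
    apply: le_trans (_ : `|C| * hnorm (y - p) <= _).
      by rewrite ler_wpM2r ?hnorm_ge0 // ler_norm.
    by apply: ler_pM; rewrite ?hnorm_ge0 ?lerDl ?normr_ge0 // ltW.
  by rewrite mulrC divfK ?gt_eqF.
pose z := x0 - p.
have fz : f z != 0 by rewrite fB fp subr0.
have zz : '[z, z] != 0.
  rewrite (dnorm_eq0 (hdot H)); apply: contra_neq fz => ->; exact: f0.
exists (((f z / '[z, z])^* )%R *: z) => x.
rewrite dotZr conjCK.
have := xp (x - (f x / f z) *: z).
rewrite /A /= fB fZ divfK // subrr => /(_ erefl) h.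
have : '[x - (f x / f z) *: z, z] = 0 by rewrite dotC h rmorph0.
rewrite dotBl dotZl => /eqP; rewrite subr_eq0 => /eqP ->.
by field; rewrite fz zz.
Qed.

End Projection.

(** * Bounded operators *)

Record bop (R : realType) (G K : hilbert R) := Bop {
  bfun :> G -> K;
  bop_lin : linear bfun;
  bop_bnd : exists2 C : R, 0 <= C & forall x, hnorm (bfun x) <= C * hnorm x }.

HB.instance Definition _ (R : realType) (G K : hilbert R) (A : bop G K) :=
  GRing.isLinear.Build R[i] G K *:%R (bfun A) (@bop_lin R G K A).

Section Operators.
Variables (R : realType).

Lemma bop_n2 (G K : hilbert R) (f : G -> K) (C : R) : linear f -> 
  (forall x, n2 (f x) <= C * n2 x) -> exists A : bop G K, forall x, A x = f x.
Proof.
move=> fL fC.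
suff h : exists2 C : R, 0 <= C & forall x, hnorm (f x) <= C * hnorm x.
  by exists (Bop fL h).
exists (1 + `|C|) => [|x]; first exact: addr_ge0.
rewrite -(@ler_pXn2r _ 2) ?nnegrE ?mulr_ge0 ?addr_ge0 ?hnorm_ge0 //.
rewrite exprMn !n2E; apply: le_trans (fC x) _; apply: ler_wpM2r; first exact: n2_ge0.
apply: le_trans (ler_norm _) _; have : 0 <= `|C| by []; nra.
Qed.

Section Adjoint.
Variables (G K : hilbert R) (A : bop G K).

Lemma adjoint_exists : exists B : bop K G, forall x y, '[A x, y] = '[x, B y].
Proof.
have [C C0 hC] := bop_bnd A.
have /choice[f fP] : forall y, exists z, forall x, '[A x, y] = '[x, z].
  move=> y; apply: (@riesz R G (fun x => '[A x, y]) (C * hnorm y)) => [a x x'|x].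
    by rewrite linearP dotDl dotZl.
  apply: le_trans (cauchy_schwarz_norm _ _) _.
  by rewrite mulrAC ler_wpM2r ?hnorm_ge0.
have fL : linear f.
  move=> a y y'; apply: dot_ext => z; rewrite dotC [RHS]dotC; congr conjC.
  by rewrite -fP !(dotDr, dotZr) !fP.
have fB y : hnorm (f y) <= C * hnorm y.
  have := cauchy_schwarz_norm (A (f y)) y; rewrite fP dotxx normcR -n2E.
  rewrite ger0_norm ?sqr_ge0 // => h.
  have [->|f0] := eqVneq (hnorm (f y)) 0.
    by rewrite mulr_ge0 ?hnorm_ge0.
  have fp : 0 < hnorm (f y) by rewrite lt_def f0 hnorm_ge0.
  rewrite -(ler_pM2r fp) -expr2; apply: le_trans h _.
  by rewrite mulrAC ler_wpM2r ?hnorm_ge0.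
exists (Bop fL (ex_intro2 _ _ C C0 fB)) => x y; exact: fP.
Qed.

Definition adj : bop K G := projT1 (cid adjoint_exists).
Lemma adjP x y : '[A x, y] = '[x, adj y].
Proof. exact: (projT2 (cid adjoint_exists)). Qed.
Lemma adjPl x y : '[adj y, x] = '[y, A x].
Proof. by rewrite dotC -adjP -dotC. Qed.
End Adjoint.

Definition total_family (G : hilbert R) (J : Type) (f : J -> G) :=
  forall x : G, (forall j, '[x, f j] = 0) -> x = 0.

Lemma total_ext (G : hilbert R) (J : Type) (f : J -> G) x y :
  total_family f -> (forall j, '[x, f j] = '[y, f j]) -> x = y.
Proof.
move=> fT h; apply/eqP; rewrite -subr_eq0; apply/eqP/fT => j.
by rewrite dotBl h subrr.
Qed.

(** Bounded operators are determined on a total family, as their adjoints are. *)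
Lemma total_bop (G K : hilbert R) (J : Type) (f : J -> G) (A B : bop G K) :
  total_family f -> (forall j, A (f j) = B (f j)) -> forall x, A x = B x.
Proof.
move=> fT h x; apply: dot_ext => y; rewrite !adjP; congr '[x, _].
by apply: (total_ext fT) => j; rewrite !adjPl h.
Qed.

Definition bid (G : hilbert R) : bop G G.
Proof.
exists idfun; first by [].
by exists 1 => // x; rewrite mul1r.
Defined.

Definition bcomp (G K M : hilbert R) (A : bop K M) (B : bop G K) : bop G M.
Proof.
exists (fun x => A (B x)); first by move=> a x y; rewrite !linearP.
have [C C0 hC] := bop_bnd A; have [D D0 hD] := bop_bnd B.
exists (C * D) => [|x]; first exact: mulr_ge0.
by apply: le_trans (hC _) _; rewrite -mulrA ler_wpM2l.
Defined.

Lemma sum_option (V : nmodType) (I : finType) (F : option I -> V) :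
  \sum_o F o = F None + \sum_i F (Some i).
Proof.
rewrite (bigD1 None) //=; congr (_ + _).
rewrite (reindex_omap Some id) => [|[i|] //].
by apply: eq_bigl => i; rewrite eqxx.
Qed.

Lemma hsum_dot (I : finType) (G : hilbert R) (X Y : hsum I G) :
  '[X, Y] = \sum_i '[X i, Y i].
Proof. by []. Qed.
Lemma hsum_n2 (I : finType) (G : hilbert R) (X : hsum I G) :
  n2 X = \sum_i n2 (X i).
Proof. by rewrite /n2 hsum_dot raddf_sum. Qed.

(** A family [W j] with the same Gram matrix as a total family [f j] defines an
    isometry. Its graph [M] is the closed span of the pairs [(f j, W j)]; every
    [x] is in the domain because [M] is an isometric graph, so that the
    projection of [(x, 0)] on [M] is [(x, A x) / 2]. *)
Lemma isometric_extension (G : hilbert R) (J : Type) (I : finType) (f : J -> G)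
    (W : I -> J -> G) : total_family f ->
  (forall j l, '[f j, f l] = \sum_i '[W i j, W i l]) ->
  exists A : I -> bop G G, (forall i j, A i (f j) = W i j) /\
    forall x y, '[x, y] = \sum_i '[A i x, A i y].
Proof.
move=> fT fW.
pose pr (x : G) (z : I -> G) : hsum (option I) G :=
  [ffun o => if o is Some i then z i else x].
have prE x z X : '[X, pr x z] = '[X None, x] + \sum_i '[X (Some i), z i].
  rewrite hsum_dot sum_option /= ffunE; congr (_ + _).
  by apply: eq_bigr => i _; rewrite ffunE.
pose gen j := pr (f j) (fun i => W i j).
pose M : set (hsum (option I) G) := [set p | forall y,
  (forall s, range gen s -> '[y, s] = 0) -> '[p, y] = 0].
have genM j : M (gen j) by move=> y hy; rewrite dotC hy ?rmorph0 //; exists j.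
have ML a p q : M p -> M q -> M (a *: p + q).
  by move=> Mp Mq y hy; rewrite dotDl dotZl Mp // Mq // mulr0 addr0.
(* the vector [(f j, - W j)] is orthogonal to [M] *)
have M1 p j : M p -> '[p None, f j] = \sum_i '[p (Some i), W i j].
  move=> Mp; have := Mp (pr (f j) (fun i => - W i j)).
  rewrite prE => h; apply/eqP; rewrite -subr_eq0 -sumrN; apply/eqP.
  under eq_bigr do rewrite -dotNr.
  apply: h => _ [l _ <-]; rewrite prE /pr ffunE fW -big_split big1 //= => i _.
  by rewrite ffunE dotNl subrr.
have M2 p q : M p -> M q -> '[p None, q None] = \sum_i '[p (Some i), q (Some i)].
  move=> Mp Mq; have := Mp (pr (q None) (fun i => - q (Some i))).
  rewrite prE => h; apply/eqP; rewrite -subr_eq0 -sumrN; apply/eqP.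
  under eq_bigr do rewrite -dotNr.
  apply: h => _ [l _ <-]; rewrite prE /pr ffunE M1 // -big_split big1 //= => i _.
  by rewrite ffunE dotNl subrr.
have Mx x : exists p, M p /\ p None = x.
  have [p [Mp Xp]] := perp_decomp (range gen) (pr x (fun=> 0)).
  exists (2 *: p); split.
    by rewrite scaler_nat mulr2n -{1}[p]scale1r; exact: ML.
  rewrite ffunE; apply/eqP; rewrite -subr_eq0; apply/eqP/fT => j.
  have : '[pr x (fun=> 0) - p, gen j] = 0 by apply: Xp; exists j.
  rewrite prE !ffunE.
  under eq_bigr do rewrite !ffunE sub0r dotNl.
  rewrite sumrN -M1 // !dotBl dotZl => h; rewrite -[RHS]oppr0 -h; ring.
have /choice[g gP] := Mx.
have uniq p q : M p -> M q -> p None = q None -> p = q.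
  move=> Mp Mq pq; have Mpq : M (-1 *: q + p) by exact: ML.
  have e0 : (-1 *: q + p) None = 0 by rewrite !ffunE pq scaleN1r addNr.
  have := M2 _ _ Mpq Mpq; rewrite e0 dot0l.
  move=> /esym/eqP; rewrite psumr_eq0 => [/allP h|i _]; last exact: dnorm_ge0.
  apply/ffunP => -[i|//].
  have := h i (mem_index_enum i); rewrite dnorm_eq0 !ffunE scaleN1r.
  by rewrite addrC subr_eq0 => /eqP.
have gL i : linear (fun x => g x (Some i)).
  move=> a x y; have [Mx' ex] := gP x; have [My ey] := gP y.
  have [Ma ea] := gP (a *: x + y).
  by rewrite (uniq _ _ Ma (ML a _ _ Mx' My)) ?ffunE // ea ex ey.
have gD x y : '[x, y] = \sum_i '[g x (Some i), g y (Some i)].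
  by have [Mx' ex] := gP x; have [My ey] := gP y; rewrite -M2 // ex ey.
have /choice[A AP] : forall i, exists A : bop G G, forall x, A x = g x (Some i).
  move=> i; apply: (bop_n2 (C := 1) (gL i)) => x.
  rewrite mul1r {2}/n2 gD (bigD1 i) //= raddfD /= -/(n2 _) lerDl.
  rewrite raddf_sum; apply: sumr_ge0 => l _; exact: n2_ge0.
exists A; split=> [i j|x y].
  have [Mj ej] := gP (f j); rewrite AP (uniq _ _ Mj (genM j)) ?ej ?ffunE //.
by rewrite gD; apply: eq_bigr => i _; rewrite !AP.
Qed.
End Operators.

(** * The Hilbert space of square summable sequences *)

Section AbsoluteSums.
Variable R : realType.
Implicit Types (u v : nat -> R[i]) (s t a : R[i]).

(** By real and imaginary parts, so that completeness of [R] gives limits. *)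
Definition sums_to u s :=
  (series (fun n => complex.Re (u n)) @ \oo --> complex.Re s) /\
  (series (fun n => complex.Im (u n)) @ \oo --> complex.Im s).

Lemma sums_to_unique u s t : sums_to u s -> sums_to u t -> s = t.
Proof.
move=> [h1 h2] [h3 h4]; case: s t h1 h2 h3 h4 => a b [a' b'] /= h1 h2 h3 h4.
by rewrite (cvg_unique _ h1 h3) // (cvg_unique _ h2 h4).
Qed.

Lemma eq_sums_to u v s : u =1 v -> sums_to u s -> sums_to v s.
Proof. by move=> /funext ->. Qed.

Lemma Re_lin a s t : complex.Re (a * s + t) =
  complex.Re a * complex.Re s - complex.Im a * complex.Im s + complex.Re t.
Proof. by case: a s t => [? ?] [? ?] [? ?]. Qed.
Lemma Im_lin a s t : complex.Im (a * s + t) =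
  complex.Re a * complex.Im s + complex.Im a * complex.Re s + complex.Im t.
Proof. by case: a s t => [? ?] [? ?] [? ?] /=; rewrite [X in _ + X + _]mulrC. Qed.

Lemma sums_toP a u v s t :
  sums_to u s -> sums_to v t -> sums_to (fun n => a * u n + v n) (a * s + t).
Proof.
move=> [h1 h2] [h3 h4].
have E1 : series (fun n => complex.Re (a * u n + v n)) =
    (fun n => complex.Re a * series (fun n => complex.Re (u n)) n
     - complex.Im a * series (fun n => complex.Im (u n)) n
     + series (fun n => complex.Re (v n)) n).
  apply/funext => n; rewrite /series /= !mulr_sumr -sumrB -big_split /=.
  by apply: eq_bigr => i _; rewrite Re_lin.
have E2 : series (fun n => complex.Im (a * u n + v n)) =
    (fun n => complex.Re a * series (fun n => complex.Im (u n)) n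
     + complex.Im a * series (fun n => complex.Re (u n)) n
     + series (fun n => complex.Im (v n)) n).
  apply/funext => n; rewrite /series /= !mulr_sumr -!big_split /=.
  by apply: eq_bigr => i _; rewrite Im_lin.
split; rewrite ?E1 ?E2 ?Re_lin ?Im_lin.
  by apply: cvgD h3; apply: cvgB; apply: cvgM => //; exact: cvg_cst.
by apply: cvgD h4; apply: cvgD; apply: cvgM => //; exact: cvg_cst.
Qed.

Lemma sums_to_conj u s : sums_to u s -> sums_to (fun n => (u n)^* )%R (s^* )%R.
Proof.
move=> [h1 h2]; split.
  rewrite (_ : complex.Re _ = complex.Re s); last by case: (s).
  by rewrite (_ : (fun n => _) = (fun n => complex.Re (u n))) //; apply/funext => n; case: (u n).
rewrite (_ : complex.Im _ = - complex.Im s); last by case: (s).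
rewrite (_ : series _ = (fun n => - series (fun n => complex.Im (u n)) n)); first exact: cvgN.
apply/funext => n; rewrite /series /= -sumrN; apply: eq_bigr => i _; by case: (u i).
Qed.

Lemma Im_le_normc s : `|complex.Im s| <= normc s.
Proof.
case: s => a b /=; rewrite -sqrtr_sqr ler_wsqrtr // lerDr; exact: sqr_ge0.
Qed.

Lemma abs_sums_to u C : (forall N, \sum_(0 <= n < N) normc (u n) <= C) ->
  exists s, sums_to u s.
Proof.
move=> uC.
have key (f : nat -> R) : (forall n, `|f n| <= normc (u n)) -> cvgn (series f).
  move=> fu; apply: normed_cvg; apply: nondecreasing_is_cvgn.
    by apply/nondecreasing_seqP => n /=; rewrite [leRHS]/series /= big_nat_recr //= lerDl.
  exists C => _ [n _ <-]; apply: le_trans (uC n); rewrite /= [leLHS]/series /=.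
  by apply: ler_sum => i _.
have /cvg_ex[/= a ha] : cvgn (series (fun n => complex.Re (u n))).
  by apply: key => n; rewrite -lecR; exact: normc_ge_Re.
have /cvg_ex[/= b hb] : cvgn (series (fun n => complex.Im (u n))).
  by apply: key => n; exact: Im_le_normc.
by exists (Complex a b).
Qed.

End AbsoluteSums.

Section SquareSummable.
Variables (R : realType) (G : hilbert R).

Definition l2_pred : pred (nat -> G) :=
  fun x => `[< exists C, forall N, \sum_(0 <= n < N) n2 (x n) <= C >].

Lemma n2_lin (a : R[i]) (x y : G) :
  n2 (a *: x + y) <= 2 * normc a ^+ 2 * n2 x + 2 * n2 y.
Proof.
have := n2_ge0 (a *: x - y); rewrite n2B n2D n2Z; lra.
Qed.

Lemma l2_submod : GRing.subsemimod_closed l2_pred.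
Proof.
apply: GRing.submod_closed_semi; split.
  apply/asboolP; exists 0 => N; rewrite big1 // => n _; exact: n20.
move=> a x y /asboolP[C hC] /asboolP[D hD]; apply/asboolP.
exists (2 * normc a ^+ 2 * C + 2 * D) => N.
apply: le_trans (ler_sum _ (fun n _ => n2_lin a (x n) (y n))) _.
rewrite big_split /= -!mulr_sumr; apply: lerD; apply: ler_wpM2l => //.
by rewrite mulr_ge0 ?sqr_ge0.
Qed.

HB.instance Definition _ := GRing.isSubmodClosed.Build R[i] (nat -> G) l2_pred l2_submod.

Record l2_type := L2 { l2fun :> nat -> G; _ : l2fun \in l2_pred }.
HB.instance Definition _ := [isSub for l2fun].
HB.instance Definition _ := [Choice of l2_type by <:].
HB.instance Definition _ := [SubChoice_isSubLmodule of l2_type by <:].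

Implicit Types x y : l2_type.

Lemma l2_bound x : exists C, forall N, \sum_(0 <= n < N) n2 (x n) <= C.
Proof. by case: x => x /= /asboolP. Qed.

Lemma normc_dot_le (u v : G) : normc '[u, v] <= n2 u + n2 v.
Proof.
apply: le_trans (cauchy_schwarz_norm _ _) _; rewrite -!n2E.
have := sqr_ge0 (hnorm u - hnorm v); have := hnorm_ge0 u; have := hnorm_ge0 v; nra.
Qed.

Lemma l2dot_exists x y : exists s, sums_to (fun n => '[x n, y n]) s.
Proof.
have [C hC] := l2_bound x; have [D hD] := l2_bound y.
apply: (@abs_sums_to _ _ (C + D)) => N.
apply: le_trans (ler_sum _ (fun n _ => normc_dot_le (x n) (y n))) _.
by rewrite big_split lerD.
Qed.

Definition l2dot x y : R[i] := projT1 (cid (l2dot_exists x y)).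
Lemma l2dotP x y : sums_to (fun n => '[x n, y n]) (l2dot x y).
Proof. exact: (projT2 (cid (l2dot_exists x y))). Qed.

Lemma l2D x y n : (x + y) n = x n + y n. Proof. by []. Qed.
Lemma l2Z (a : R[i]) x n : (a *: x) n = a *: x n. Proof. by []. Qed.
Lemma l2N x n : (- x) n = - x n. Proof. by []. Qed.
Lemma l2_0 n : (0 : l2_type) n = 0. Proof. by []. Qed.

Lemma l2_ext x y : (forall n, x n = y n) -> x = y.
Proof. by move=> h; apply: val_inj; exact/funext. Qed.

Lemma l2dot_bilin : bilinear_for (GRing.Scale.Law.clone _ _ *%R _)
  (GRing.Scale.Law.clone _ _ (conjC \; *%R) _) l2dot.
Proof.
split=> [y a x x' | x a y y'] /=.
  apply: sums_to_unique (l2dotP _ _) _.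
  apply: eq_sums_to (sums_toP a (l2dotP x y) (l2dotP x' y)) => n.
  by rewrite dotDl dotZl.
apply: sums_to_unique (l2dotP _ _) _.
apply: eq_sums_to (sums_toP (conjC a) (l2dotP x y) (l2dotP x y')) => n.
by rewrite dotDr dotZr.
Qed.

HB.instance Definition _ := bilinear_isBilinear.Build R[i] l2_type l2_type R[i]
  *%R (conjC \; *%R) l2dot l2dot_bilin.

Lemma l2dot_herm x y : l2dot x y = (-1) ^+ false * conjC (l2dot y x).
Proof.
rewrite mul1r; apply: sums_to_unique (l2dotP _ _) _.
apply: eq_sums_to (sums_to_conj (l2dotP y x)) => n; by rewrite [RHS]dotC.
Qed.

HB.instance Definition _ := isHermitianSesquilinear.Build R[i] l2_type
  false conjC l2dot l2dot_herm.

Lemma series_n2_cvg x :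
  series (fun n => n2 (x n)) @ \oo --> complex.Re (l2dot x x).
Proof. exact: (l2dotP x x).1. Qed.

Lemma series_n2_homo x : nondecreasing_seq (series (fun n => n2 (x n))).
Proof.
by apply/nondecreasing_seqP => n; rewrite /series /= big_nat_recr //= lerDl n2_ge0.
Qed.

Lemma l2_partial_le x N : \sum_(0 <= n < N) n2 (x n) <= complex.Re (l2dot x x).
Proof.
rewrite -(cvg_lim _ (@series_n2_cvg x)) //.
apply: (nondecreasing_cvgn_le (@series_n2_homo x)).
by apply/cvg_ex; eexists; exact: series_n2_cvg.
Qed.

Lemma l2_le_bound x C : (forall N, \sum_(0 <= n < N) n2 (x n) <= C) ->
  complex.Re (l2dot x x) <= C.
Proof.
move=> h; rewrite -(cvg_lim _ (@series_n2_cvg x)) //.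
apply: limr_le; first by apply/cvg_ex; eexists; exact: series_n2_cvg.
by apply: nearW => n; exact: h.
Qed.

Lemma l2dot_real x : l2dot x x = (complex.Re (l2dot x x))%:C.
Proof.
apply: sums_to_unique (l2dotP _ _) _; split; first exact: series_n2_cvg.
rewrite (_ : series _ = fun=> 0); first exact: cvg_cst.
by apply/funext => n; rewrite /series /= big1 //= => i _; rewrite dotxx.
Qed.

Lemma l2dot_gt0 x : x != 0 -> 0 < l2dot x x.
Proof.
move=> x0; have [n xn] : exists n, x n != 0.
  apply/not_existsP => h; move/eqP: x0; apply; apply: l2_ext => n.
  by apply/eqP; apply: contrapT => /negP; exact: h.
rewrite l2dot_real ltcR.
apply: lt_le_trans (l2_partial_le x n.+1).
rewrite big_nat_recr //= ltr_wpDl ?sumr_ge0 // => [i _|]; first exact: n2_ge0.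
by rewrite lt_def n2_ge0 andbT; apply: contra_neq xn; exact: n2_eq0.
Qed.

HB.instance Definition _ := isDotProduct.Build R[i] l2_type l2dot l2dot_gt0.

Definition l2dot_dot : {dot l2_type for conjC} := l2dot.

Lemma coord_le x n : hnorm (x n) <= dotnorm l2dot_dot x.
Proof.
rewrite /hnorm /dotnorm ler_wsqrtr //; apply: le_trans (l2_partial_le x n.+1).
by rewrite big_nat_recr //= lerDr sumr_ge0 // => i _; exact: n2_ge0.
Qed.

(** The limit is taken coordinatewise; a partial sum of [n2 (u m - l)] is
    compared with that of [n2 (u m - u k)] for [k] large, at the cost of the
    factor [2] of [n2_lin]. *)
Lemma l2dot_complete : dot_complete l2dot_dot.
Proof.
move=> u uC.
have /choice[l lP] : forall n, exists l : G,
    dotnorm (hdot G) (u m n - l) @[m --> \oo] --> (0 : R).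
  move=> n; apply: (@hcomplete R G (fun m => u m n)) => e /uC[N uN].
  exists N => m k Nm Nk; apply: le_lt_trans (uN m k Nm Nk).
  exact: (coord_le (u m - u k) n).
(* finitely many coordinates converge uniformly *)
have small M (e : R) : 0 < e -> exists K, forall k, (K <= k)%N ->
    \sum_(0 <= n < M) n2 (u k n - l n) < e.
  elim: M e => [|M IH] e e0.
    by exists 0%N => k _; rewrite big_nil.
  have [|K1 h1] := IH (e / 2); first by lra.
  have [|K2 h2] := cvg0_eventually (lP M) (_ : 0 < Num.min 1 (e / 2)).
    by rewrite lt_min ltr01 /=; lra.
  exists (maxn K1 K2) => k; rewrite geq_max => /andP[hk1 hk2].
  rewrite big_nat_recr //= [e]splitr; apply: ltrD; first exact: h1.
  have := h2 _ hk2; rewrite ger0_norm ?hnorm_ge0 // -n2E -/(hnorm _) lt_min.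
  have := hnorm_ge0 (u k M - l M); set t := hnorm _; move=> t0 /andP[t1 te]; nra.
have est (e : R) : 0 < e -> exists K, forall m, (K <= m)%N -> forall M,
    \sum_(0 <= n < M) n2 (u m n - l n) <= 4 * e ^+ 2.
  move=> e0; have [K hK] := uC e e0; exists K => m Km M.
  have e2 : 0 < e ^+ 2 by rewrite exprn_gt0.
  have [K' hK'] := small M _ e2.
  pose k := maxn K K'.
  have hk := hK' k (leq_maxr _ _).
  have hmk := hK m k Km (leq_maxl _ _).
  have h1 : \sum_(0 <= n < M) n2 (u m n - u k n) <= e ^+ 2.
    apply: le_trans (l2_partial_le (u m - u k) M) _.
    rewrite -[leLHS]sqr_sqrtr; last first.
      by apply: le_trans (l2_partial_le _ 0); rewrite big_nil.
    by rewrite ler_pXn2r ?nnegrE ?sqrtr_ge0 ?ltW.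
  apply: le_trans (_ : \sum_(0 <= n < M) (2 * n2 (u m n - u k n) + 2 * n2 (u k n - l n)) <= _).
    apply: ler_sum => n _.
    have := n2_lin 1 (u m n - u k n) (u k n - l n).
    by rewrite scale1r addrA subrK Normc.normc1 expr1n mulr1.
  rewrite big_split /= -!mulr_sumr; lra.
have lL : l \in l2_pred.
  have [K hK] := est 1 ltr01.
  have [C hC] := l2_bound (u K).
  apply/asboolP; exists (2 * C + 8) => N.
  apply: le_trans (_ : \sum_(0 <= n < N) (2 * n2 (u K n) + 2 * n2 (u K n - l n)) <= _).
    apply: ler_sum => n _.
    have := n2_lin (-1) (u K n - l n) (u K n).
    rewrite scaleN1r opprB subrK normcN Normc.normc1 expr1n; lra.
  rewrite big_split /= -!mulr_sumr; have := hC N; have := hK K (leqnn _) N; lra.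
exists (L2 lL); apply/cvgr0Pnorm_lt => e e0.
have [|K hK] := est (e / 4); first by lra.
exists K => // m /hK h /=; rewrite ger0_norm ?sqrtr_ge0 //.
rewrite -(@ltr_pXn2r _ 2) ?nnegrE ?sqrtr_ge0 ?ltW // sqr_sqrtr; last first.
  by apply: le_trans (l2_partial_le _ 0); rewrite big_nil.
have h' := @l2_le_bound (u m - L2 lL) _ h.
apply: le_lt_trans h' _; nra.
Qed.

Definition l2 : hilbert R := Hilbert l2dot_complete.

End SquareSummable.
Arguments l2fun : simpl never.

Section L2Theory.
Variables (R : realType) (G : hilbert R).
Implicit Types x y : l2 G.

Lemma l2_dotE x y : sums_to (fun n => '[x n, y n]) '[x, y].
Proof. exact: l2dotP. Qed.
Lemma n2_partial_le x N : \sum_(0 <= n < N) n2 (x n) <= n2 x.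
Proof. exact: l2_partial_le. Qed.
Lemma n2_le_bound x C : (forall N, \sum_(0 <= n < N) n2 (x n) <= C) -> n2 x <= C.
Proof. exact: l2_le_bound. Qed.

Lemma l2_mk (f : nat -> G) C : (forall N, \sum_(0 <= n < N) n2 (f n) <= C) ->
  exists x : l2 G, forall n, x n = f n.
Proof.
move=> h; have fl : f \in @l2_pred R G by apply/asboolP; exists C.
by exists (L2 fl : l2 G).
Qed.

Definition delta_seq (n : nat) (g : G) (m : nat) : G := if m == n then g else 0.

Lemma sum_delta_seq n g N :
  \sum_(0 <= m < N) n2 (delta_seq n g m) <= n2 g.
Proof.
apply: le_trans (_ : \sum_(0 <= m < N | m == n) n2 g <= _).
  rewrite [leRHS]big_mkcond; apply: ler_sum => m _; rewrite /delta_seq.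
  by case: eqP => // _; rewrite n20.
by rewrite big_nat1_eq; case: ifP; rewrite ?n2_ge0.
Qed.

Definition single n (g : G) : l2 G := projT1 (cid (l2_mk (sum_delta_seq n g))).
Lemma singleE n g m : single n g m = if m == n then g else 0.
Proof. exact: (projT2 (cid (l2_mk (sum_delta_seq n g)))). Qed.

Lemma sums_to_single (n : nat) (c : R[i]) :
  sums_to (fun m => if m == n then c else 0) c.
Proof.
have key (t : R) : series (fun m => if m == n then t else 0) @ \oo --> t.
  apply: cvg_near_cst; exists n.+1 => // m /= nm.
  rewrite /series /= -big_mkcond /=.
  by rewrite big_nat1_eq /= nm.
split.
  rewrite (_ : (fun m => _) = fun m => if m == n then complex.Re c else 0); first exact: key.
  by apply/funext => m; case: eqP.
rewrite (_ : (fun m => _) = fun m => if m == n then complex.Im c else 0); first exact: key.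
by apply/funext => m; case: eqP.
Qed.

Lemma dot_single x n g : '[x, single n g] = '[x n, g].
Proof.
apply: sums_to_unique (l2_dotE _ _) _.
apply: eq_sums_to (sums_to_single n '[x n, g]) => m; rewrite singleE.
by case: eqP => [->|_] //; rewrite dot0r.
Qed.

Lemma total_single (J : Type) (f : J -> G) : total_family f ->
  total_family (fun p : nat * J => single p.1 (f p.2)).
Proof.
move=> fT x h; apply: l2_ext => n; apply: fT => j.
by rewrite -dot_single (h (n, j)).
Qed.

Lemma l2_dot_ext x y : (forall n g, '[x, single n g] = '[y, single n g]) -> x = y.
Proof.
by move=> h; apply: l2_ext => n; apply: dot_ext => g; rewrite -!dot_single h.
Qed.

Lemma l2_sum I r (P : pred I) (F : I -> l2 G) n :
  (\sum_(i <- r | P i) F i) n = \sum_(i <- r | P i) F i n.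
Proof.
elim: r => [|i r IH]; first by rewrite !big_nil.
by rewrite !big_cons; case: ifP; rewrite ?l2D IH.
Qed.

End L2Theory.

(** * Operators on sequences and the shifts *)

Section L2Operators.
Variable R : realType.
Implicit Types G K : hilbert R.

Lemma l2_bop G K (f : G -> nat -> K) (C : R) : (forall n, linear (f^~ n)) ->
  (forall x N, \sum_(0 <= n < N) n2 (f x n) <= C * n2 x) ->
  exists A : bop G (l2 K), (forall x n, A x n = f x n) /\
     forall x, n2 (A x) <= C * n2 x.
Proof.
move=> fL fC; have /choice[g gE] : forall x, exists y : l2 K, forall n, y n = f x n.
  by move=> x; exact: (l2_mk (fC x)).
have gC x : n2 (g x) <= C * n2 x.
  by apply: n2_le_bound => N; under eq_bigr do rewrite gE.
have gL : linear g.
  by move=> a x y; apply: l2_ext => n; rewrite l2D l2Z !gE fL.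
have [A AE] := bop_n2 gL gC.
by exists A; split=> [x n|x]; rewrite AE.
Qed.

Lemma bop_n2_bound G K (A : bop G K) : exists2 C, 0 <= C & forall x, n2 (A x) <= C * n2 x.
Proof.
have [C C0 hC] := bop_bnd A; exists (C ^+ 2) => [|x]; first exact: sqr_ge0.
by rewrite -!n2E -exprMn ler_pXn2r ?nnegrE ?mulr_ge0 ?hnorm_ge0.
Qed.

Lemma lmap_exists G K (A : bop G K) : exists B : bop (l2 G) (l2 K),
  forall x n, B x n = A (x n).
Proof.
have [C C0 hC] := bop_n2_bound A.
have [|x N|B [BE _]] := @l2_bop (l2 G) K (fun x n => A (x n)) C.
- by move=> n a x y; rewrite l2D l2Z linearP.
- apply: le_trans (_ : \sum_(0 <= n < N) C * n2 (x n) <= _).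
    by apply: ler_sum => n _.
  by rewrite -mulr_sumr ler_wpM2l // n2_partial_le.
by exists B.
Qed.

Definition lmap G K (A : bop G K) := projT1 (cid (lmap_exists A)).
Lemma lmapE G K (A : bop G K) x n : lmap A x n = A (x n).
Proof. exact: (projT2 (cid (lmap_exists A))). Qed.

Lemma lmap_single G K (A : bop G K) n g : lmap A (single n g) = single n (A g).
Proof.
by apply: l2_ext => m; rewrite lmapE !singleE; case: eqP => // _; rewrite linear0.
Qed.

Lemma lmap_parseval G K (I : finType) (P : I -> bop G K) :
  (forall x y, '[x, y] = \sum_i '[P i x, P i y]) ->
  forall x y : l2 G, '[x, y] = \sum_i '[lmap (P i) x, lmap (P i) y].
Proof.
move=> hP x y.
have xE : x = \sum_i adj (lmap (P i)) (lmap (P i) x).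
  apply: l2_dot_ext => n g; rewrite dot_suml dot_single hP.
  by apply: eq_bigr => i _; rewrite adjPl lmap_single dot_single lmapE.
rewrite {1}xE dot_suml; apply: eq_bigr => i _; exact: adjPl.
Qed.

End L2Operators.

(** The index set of [l2 G] is read as the set of words in [d.+1] letters,
    stored as a heap: [0] is the empty word and [(m * d.+1 + j).+1] is the word
    of [m] with the letter [j] put in front. Then [l2 G] is the full Fock space
    on [d.+1] letters tensored with [G], [fshift j] is the left creation
    operator of the letter [j], and [bshift j] is its adjoint. *)

Section Shifts.
Variables (R : realType) (d : nat) (G : hilbert R).
Implicit Types (x y : l2 G) (i j : 'I_d.+1).

Lemma bshift_bound j (f : nat -> R) N : (forall n, 0 <= f n) ->
  \sum_(0 <= m < N) f (m * d.+1 + j).+1 <= \sum_(0 <= n < (N * d.+1).+1) f n.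
Proof.
move=> f0; elim: N => [|N IH]; first by rewrite big_nil sumr_ge0.
rewrite big_nat_recr //= [leRHS](@big_cat_nat _ _ _ (N * d.+1).+1) //=; last first.
  by rewrite ltnS leq_mul2r leqnSn orbT.
apply: lerD => //.
have jN : (N * d.+1 + j).+1 \in index_iota (N * d.+1).+1 (N.+1 * d.+1).+1.
  by rewrite mem_index_iota ltnS leq_addr /= ltnS mulSn addnC ltn_add2r.
by rewrite (big_rem _ jN) /= lerDl sumr_ge0.
Qed.

Lemma bshift_exists j : exists B : bop (l2 G) (l2 G),
  forall x m, B x m = x (m * d.+1 + j).+1.
Proof.
have [//|x N|B [BE _]] := @l2_bop R (l2 G) G (fun x m => x (m * d.+1 + j).+1) 1.
  rewrite mul1r; apply: le_trans (n2_partial_le x (N * d.+1).+1).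
  by apply: (bshift_bound j N (f := fun n => n2 (x n))) => n; exact: n2_ge0.
by exists B.
Qed.

Definition bshift j := projT1 (cid (bshift_exists j)).
Lemma bshiftE j x m : bshift j x m = x (m * d.+1 + j).+1.
Proof. exact: (projT2 (cid (bshift_exists j)) x m). Qed.

Definition fshift j : bop (l2 G) (l2 G) := adj (bshift j).
Lemma dot_fshiftl j x y : '[fshift j x, y] = '[x, bshift j y].
Proof. exact: adjPl. Qed.
Lemma dot_fshiftr j x y : '[x, fshift j y] = '[bshift j x, y].
Proof. by rewrite adjP. Qed.

Lemma heap_eq m n i j : ((m * d.+1 + i).+1 == (n * d.+1 + j).+1) = (m == n) && (i == j).
Proof.
rewrite eqSS; apply/eqP/andP => [h|[/eqP -> /eqP ->] //].
have hm := congr1 (modn^~ d.+1) h; have hd := congr1 (divn^~ d.+1) h.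
rewrite /= !modnMDl !modn_small // in hm.
rewrite /= !divnMDl // !divn_small // !addn0 in hd.
by split; apply/eqP => //; apply: val_inj.
Qed.

Lemma fshift0 j x : fshift j x 0%N = 0.
Proof.
apply: dot_ext => g; rewrite -dot_single dot_fshiftl dot0l.
rewrite (_ : bshift j _ = 0) ?dot0r //.
by apply: l2_ext => m; rewrite bshiftE singleE.
Qed.

Lemma fshiftS i j x m : fshift j x (m * d.+1 + i).+1 = if i == j then x m else 0.
Proof.
apply: dot_ext => g; rewrite -dot_single dot_fshiftl.
rewrite (_ : bshift j _ = if i == j then single m g else 0).
  by case: ifP => _; rewrite ?dot_single ?dot0r ?dot0l.
apply: l2_ext => n; rewrite bshiftE singleE heap_eq [j == i]eq_sym.
by case: (i == j); rewrite ?andbT ?andbF ?singleE.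
Qed.

Lemma bshift_fshift i j x : bshift i (fshift j x) = if i == j then x else 0.
Proof.
by apply: l2_ext => m; rewrite bshiftE fshiftS; case: eqP.
Qed.

Lemma heapP n : n = 0%N \/ exists m, exists i : 'I_d.+1, n = (m * d.+1 + i).+1.
Proof.
case: n => [|n]; [by left|right].
 exists (n %/ d.+1)%N, (Ordinal (ltn_pmod n (ltn0Sn d))).
by rewrite /= -divn_eq.
Qed.

Lemma shift_decomp x : x = single 0 (x 0%N) + \sum_j fshift j (bshift j x).
Proof.
apply: l2_ext => n; rewrite l2D l2_sum.
have [->|[m [i ->]]] := heapP n.
  by rewrite singleE eqxx big1 ?addr0 // => j _; rewrite fshift0.
rewrite singleE /= add0r (bigD1 i) //= fshiftS eqxx bshiftE big1 ?addr0 // => j ji.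
by rewrite fshiftS eq_sym (negPf ji).
Qed.

Lemma dot_shift x y :
  '[x, y] = '[x 0%N, y 0%N] + \sum_j '[bshift j x, bshift j y].
Proof.
rewrite [y in LHS]shift_decomp dotDr dot_single dot_sumr; congr (_ + _).
by apply: eq_bigr => j _; rewrite dot_fshiftr.
Qed.
End Shifts.
Arguments bshift {R d G} j.
Arguments fshift {R d G} j.

Lemma lmap_fshift (R : realType) d (G K : hilbert R) (A : bop G K) (j : 'I_d.+1) x :
  lmap A (fshift j x) = fshift j (lmap A x).
Proof.
apply: l2_ext => n; rewrite lmapE; have [->|[m [i ->]]] := heapP d n.
  by rewrite !fshift0 linear0.
by rewrite !fshiftS; case: eqP => _; rewrite ?lmapE ?linear0.
Qed.

(** * The coextension to the Fock space *)

Section Words.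
Variable d : nat.

Definition heap_letter (n : nat) : 'I_d.+1 := Ordinal (ltn_pmod n (ltn0Sn d)).

Fixpoint heap_word_rec (fuel n : nat) : seq 'I_d.+1 :=
  match fuel, n with
  | fuel'.+1, n'.+1 => heap_letter n' :: heap_word_rec fuel' (n' %/ d.+1)%N
  | _, _ => [::]
  end.

(** The word at node [n] of the complete [d.+1]-ary tree stored as a heap: the
    root is [0] and the [i]-th child of [m] is [(m * d.+1 + i).+1]. *)
Definition heap_word n := heap_word_rec n n.

Lemma heap_word_fuel fuel n : (n <= fuel)%N -> heap_word_rec fuel n = heap_word n.
Proof.
elim/ltn_ind: n fuel => -[|n] IH [|fuel] //= nf; congr (_ :: _).
have nn : (n %/ d.+1 <= n)%N by exact: leq_div.
by rewrite [LHS]IH ?[RHS]IH ?ltnS //; exact: leq_trans nn nf.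
Qed.

Lemma heap_wordS m (i : 'I_d.+1) : heap_word (m * d.+1 + i).+1 = i :: heap_word m.
Proof.
rewrite /heap_word /=.
have -> : ((m * d.+1 + i) %/ d.+1)%N = m by rewrite divnMDl // divn_small ?addn0.
rewrite heap_word_fuel; last first.
  by apply: leq_trans (leq_addr _ _); rewrite leq_pmulr.
by congr (_ :: _); apply: val_inj; rewrite /= modnMDl modn_small.
Qed.

Lemma sum_heap (R : realType) (f : nat -> R) N :
  \sum_(0 <= n < N * d.+1) f n = \sum_(0 <= m < N) \sum_(i < d.+1) f (m * d.+1 + i)%N.
Proof.
elim: N => [|N IH]; first by rewrite !big_nil.
rewrite [RHS]big_nat_recr //= -IH [LHS](@big_cat_nat _ _ _ (N * d.+1)%N) //=; last first.
  by rewrite leq_mul2r leqnSn orbT.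
congr (_ + _); rewrite -{1}[(N * d.+1)%N]add0n mulSn big_addn addnK big_mkord.
by apply: eq_bigr => i _; rewrite addnC.
Qed.

(** The first letter acts first, as for the adjoint of a product of shifts. *)
Definition word_act (G : Type) (T : 'I_d.+1 -> G -> G) (w : seq 'I_d.+1) (x : G) : G :=
  foldl (fun y i => T i y) x w.

End Words.

Lemma word_act_linear (R : realType) d (G : hilbert R) (T : 'I_d.+1 -> bop G G) w :
  linear (word_act T w).
Proof. by elim: w => [//|i w IH] a x y; rewrite /word_act /= linearP; exact: IH. Qed.

(** A tuple [T] with defect operator [D] is embedded in the backward shifts of
    the Fock space by [x |-> (D (T_w x))_w]. This map is a contraction by the
    defect identity, and it is isometric because the [T i] have a total family
    of joint eigenvectors, with [lam1] for the eigenvalues. *)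

Section Coextension.
Variables (R : realType) (d : nat) (G : hilbert R) (T : 'I_d.+1 -> bop G G)
  (D : bop G G) (J : Type) (f : J -> G) (lam : J -> 'I_d.+1 -> R[i]).
Hypothesis fT : total_family f.
Hypothesis defect : forall x y, '[x, y] = '[D x, D y] + \sum_i '[T i x, T i y].
Hypothesis eigen : forall i j, T i (f j) = lam j i *: f j.
Hypothesis lam1 : forall j l, \sum_i lam j i * (lam l i)^* %R != 1.

Lemma defect_n2 x : n2 x = n2 (D x) + \sum_i n2 (T i x).
Proof. by rewrite {1}/n2 defect raddfD /= raddf_sum. Qed.

(** Iterating [defect_n2] along the tree: the node [(m * d.+1 + i).+1] below
    [x] is the node [m] below [T i x]. *)
Lemma coext_bound x N :
  \sum_(0 <= n < N) n2 (D (word_act T (heap_word d n) x)) <= n2 x.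
Proof.
elim: N x => [|N IH] x; first by rewrite big_nil n2_ge0.
rewrite big_nat_recl //= [leRHS]defect_n2 lerD2l.
set g := fun n => n2 (D (word_act T (heap_word d n.+1) x)).
have g0 n : 0 <= g n by exact: n2_ge0.
apply: le_trans (_ : \sum_(0 <= n < N * d.+1) g n <= _).
  rewrite [leRHS](@big_cat_nat _ _ _ N) //=; last by rewrite leq_pmulr.
  by rewrite lerDl sumr_ge0.
rewrite sum_heap exchange_big /=; apply: ler_sum => i _.
apply: le_trans (IH (T i x)); apply: ler_sum => m _.
by rewrite /g heap_wordS.
Qed.

Lemma coext_exists : exists A : bop G (l2 G),
  forall x n, A x n = D (word_act T (heap_word d n) x).
Proof.
have [|x N|A [AE _]] := @l2_bop R G G (fun x n => D (word_act T (heap_word d n) x)) 1.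
- by move=> n a x y; rewrite word_act_linear linearP.
- by rewrite mul1r coext_bound.
by exists A.
Qed.

Definition coext := projT1 (cid coext_exists).
Lemma coextE x n : coext x n = D (word_act T (heap_word d n) x).
Proof. exact: (projT2 (cid coext_exists) x n). Qed.

Lemma bshift_coext i x : bshift i (coext x) = coext (T i x).
Proof. by apply: l2_ext => m; rewrite bshiftE !coextE heap_wordS. Qed.

(** On eigenvectors both sides solve the same equation [s = c + r s] with
    [r != 1], so no convergence along the tree has to be studied. *)
Lemma coext_isometry x y : '[coext x, coext y] = '[x, y].
Proof.
suff h z : bcomp (adj coext) coext z = bid G z by rewrite adjP -[RHS](congr1 (fun u => '[x, u]) (h y)).
apply: (total_bop fT) => j; apply: (total_ext fT) => l.
rewrite /= adjPl.
have h1 := dot_shift d (coext (f j)) (coext (f l)).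
have h2 := defect (f j) (f l).
have i0 z' : coext z' 0%N = D z' by rewrite coextE.
rewrite !i0 in h1.
have e (K : hilbert R) (A : bop G K) : \sum_i '[A (T i (f j)), A (T i (f l))] =
    (\sum_i lam j i * (lam l i)^* %R) * '[A (f j), A (f l)].
  rewrite mulr_suml; apply: eq_bigr => i _.
  have AZ a v : A (a *: v) = a *: A v by exact: linearZ.
  by rewrite !eigen !AZ dotZl dotZr mulrA.
rewrite (e _ (bid G)) /= in h2.
rewrite (eq_bigr (fun i => '[coext (T i (f j)), coext (T i (f l))])) in h1; last first.
  by move=> i _; rewrite !bshift_coext.
rewrite e in h1.
have r1 : 1 - \sum_i lam j i * (lam l i)^* %R != 0 by rewrite subr_eq0 eq_sym.
apply: (mulfI r1); rewrite !mulrBl !mul1r {1}h1 {1}h2.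
by rewrite !addrK.
Qed.

End Coextension.

(** * Orthonormal families *)

Section Orthonormal.
Variables (R : realType) (K : hilbert R).

Lemma bessel (I : finType) (v : I -> K) (f : K) :
  (forall i l, '[v i, v l] = (i == l)%:R) -> \sum_i normc '[f, v i] ^+ 2 <= n2 f.
Proof.
move=> vO; pose p := \sum_i '[f, v i] *: v i.
have pv i : '[p, v i] = '[f, v i].
  rewrite /p dot_suml (bigD1 i) //= dotZl vO eqxx mulr1 big1 ?addr0 // => l li.
  by rewrite dotZl vO (negPf li) mulr0.
have zp (z : K) : (forall i, '[z, v i] = '[f, v i]) ->
    '[z, p] = (\sum_i normc '[f, v i] ^+ 2)%:C.
  move=> h; rewrite dot_sumr rmorph_sum; apply: eq_bigr => i _.
  by rewrite dotZr h mulrC -normc_sqr.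
have := n2_ge0 (f - p); rewrite n2B {2}/n2 !zp //=; lra.
Qed.

(** Gram-Schmidt. That [e 0, ..., e s.-1] and [u 0, ..., u k.-1] have the same
    span is expressed by its two uses: every subspace that contains the [u j]
    contains the [e a], and what is orthogonal to the [e a] is orthogonal to
    the [u j]. *)
Lemma gram_schmidt (k : nat) (u : nat -> K) : exists s (e : nat -> K),
  [/\ (s <= k)%N,
      forall a b, (a < s)%N -> (b < s)%N -> '[e a, e b] = (a == b)%:R,
      forall P, is_subspace P -> (forall j, (j < k)%N -> P (u j)) ->
        forall a, (a < s)%N -> P (e a)
    & forall f, (forall a, (a < s)%N -> '[f, e a] = 0) ->
        forall j, (j < k)%N -> '[f, u j] = 0].
Proof.
elim: k => [|k [s [e [sk eO eP eU]]]]; first by exists 0%N, (fun=> 0); split.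
pose r := u k - \sum_(a < s) '[u k, e a] *: e a.
have re a : (a < s)%N -> '[r, e a] = 0.
  move=> sa; rewrite /r dotBl dot_suml (bigD1 (Ordinal sa)) //= dotZl eO // eqxx mulr1.
  rewrite big1 ?addr0 ?subrr // => b ba; rewrite dotZl eO //.
  rewrite (_ : (b == a :> nat) = false) ?mulr0 //.
  by apply: contraNF ba => /eqP h; apply/eqP/val_inj.
have fr f : (forall a, (a < s)%N -> '[f, e a] = 0) -> '[f, u k] = '[f, r].
  move=> h; rewrite /r dotBr dot_sumr big1 ?subr0 // => a _.
  by rewrite dotZr h ?mulr0.
have [r0|r0] := eqVneq r 0.
  exists s, e; split=> //; first exact: leq_trans sk _.
    by move=> P PL Pu; apply: eP => // j jk; apply: Pu; exact: leq_trans jk _.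
  move=> f h j; rewrite ltnS leq_eqVlt => /predU1P[->|]; last exact: eU.
  by rewrite fr // r0 dot0r.
have nr : 0 < n2 r.
  by rewrite lt_def n2_ge0 andbT; apply: contra_neq r0; exact: n2_eq0.
have hr : 0 < hnorm r by rewrite sqrtr_gt0.
pose es := (hnorm r)^-1%:C *: r.
exists s.+1, (fun a => if (a < s)%N then e a else es); split=> //.
- have e1 : '[es, es] = 1.
    rewrite dotxx n2Z normcR -n2E ger0_norm ?invr_ge0 ?ltW //.
    by rewrite -exprMn mulVf ?gt_eqF // expr1n.
  have e2 a : (a < s)%N -> '[es, e a] = 0 by move=> sa; rewrite dotZl re // mulr0.
  move=> a b; rewrite !ltnS => ha hb.
  case: ltnP => sa; case: ltnP => sb.
  + exact: eO.
  + by rewrite dotC e2 // rmorph0 (ltn_eqF (leq_trans sa sb)).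
  + by rewrite e2 // (gtn_eqF (leq_trans sb sa)).
  + have -> : a = b by apply/eqP; rewrite eqn_leq (leq_trans ha sb) (leq_trans hb sa).
    by rewrite e1 eqxx.
- move=> P PL Pu a _; have Pe := eP P PL (fun j jk => Pu j (leq_trans jk (leqnSn k))).
  case: ifP => [|_]; first exact: Pe.
  have [P0 PP] := PL; rewrite -[es]addr0; apply: (PP) => //.
  rewrite /r -scaleN1r addrC.
  apply: (PP); last exact: Pu.
  by elim/big_ind: _ => [//|y z Py Pz|a' _]; [rewrite -[y]scale1r|rewrite -[_ *: _]addr0]; apply: (PP) => //; exact: Pe.
- move=> f h j.
  have hs a : (a < s)%N -> '[f, e a] = 0.
    by move=> sa; have := h a (ltnW sa); rewrite sa.
  rewrite ltnS leq_eqVlt => /predU1P[->|]; last exact: eU.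
  rewrite fr //; have := h s (ltnSn s); rewrite ltnn dotZr => /eqP.
  rewrite mulf_eq0 => /orP[|/eqP //].
  by rewrite fmorph_eq0 (inj_eq (@complexI R)) invr_eq0 gt_eqF.
Qed.

End Orthonormal.

Section ShiftWords.
Variables (R : realType) (d : nat) (G : hilbert R).
Implicit Types (f g : l2 G) (w : seq 'I_d.+1).

Definition fshift_word w f : l2 G := foldr (fun (i : 'I_d.+1) (g : l2 G) => fshift i g : l2 G) f w.

Lemma dot_fshift_word w f g :
  '[fshift_word w f, g] = '[f, word_act (fun i : 'I_d.+1 => @bshift R d G i) w g].
Proof.
elim: w g => [//|i w IH] g; rewrite /fshift_word /= dot_fshiftl IH //.
Qed.
Lemma dot_fshift_wordr w f g :
  '[g, fshift_word w f] = '[word_act (fun i : 'I_d.+1 => @bshift R d G i) w g, f].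
Proof. by rewrite dotC dot_fshift_word -dotC. Qed.

Lemma heap_word_inj : injective (heap_word d).
Proof.
elim/ltn_ind => m IH n.
have [->|[m' [i em]]] := heapP d m; have [->|[n' [l ->]]] := heapP d n.
- by [].
- by rewrite heap_wordS.
- by rewrite em heap_wordS.
rewrite {1}em !heap_wordS => -[il h]; rewrite em il; congr (_ * _ + _).+1.
apply: IH => //; rewrite em ltnS.
by apply: leq_trans (leq_addr _ _); rewrite leq_pmulr.
Qed.
End ShiftWords.

(** * Factorization through finite multiplicity *)

(** [T] is a tuple of operators with defect operator the projection on the unit
    vector [Om], and [kap v] a total family of joint eigenvectors; in the
    application, the backward shifts and the reproducing kernels of the
    Drury-Arveson space. *)

Section Core.
Variables (R : realType) (d : nat) (H : hilbert R) (Z : Type).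
Variables (T : 'I_d.+1 -> bop H H) (Om : H) (kap : Z -> H) (lam : Z -> 'I_d.+1 -> R[i]).
Hypothesis kapT : total_family kap.
Hypothesis Tkap : forall i v, T i (kap v) = lam v i *: kap v.
Hypothesis kapOm : forall v, '[kap v, Om] = 1.
Hypothesis Om1 : '[Om, Om] = 1.
Hypothesis defect : forall x y,
  '[x, y] = '[x, Om] * '[Om, y] + \sum_i '[T i x, T i y].
Hypothesis lam1 : forall u v, \sum_i lam u i * (lam v i)^* %R != 1.

Lemma const_part_exists : exists A : bop H H, forall x, A x = '[x, Om] *: Om.
Proof.
apply: (bop_n2 (C := n2 Om)) => [a x y|x].
  by rewrite dotDl dotZl scalerDl scalerA.
rewrite n2Z mulrC ler_wpM2l ?n2_ge0 //.
have := cauchy_schwarz x Om; rewrite (_ : n2 Om = 1) ?mulr1 //.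
by rewrite /n2 Om1.
Qed.

Let D0 := projT1 (cid const_part_exists).
Let D0E x : D0 x = '[x, Om] *: Om.
Proof. exact: (projT2 (cid const_part_exists)). Qed.

Let G := l2 H.
Let D : bop G G := lmap D0.
Let TG i : bop G G := lmap (T i).
Let kapG (p : nat * Z) : G := single p.1 (kap p.2).
Let lamG (p : nat * Z) := lam p.2.

Let kapGT : total_family kapG. Proof. exact: total_single. Qed.

Let TkapG i p : TG i (kapG p) = lamG p i *: kapG p.
Proof.
rewrite /TG /kapG lmap_single Tkap; apply: l2_ext => n.
by rewrite l2Z !singleE; case: eqP; rewrite ?scaler0.
Qed.

Let DkapG p : D (kapG p) = single p.1 Om.
Proof. by rewrite /D /kapG lmap_single D0E kapOm scale1r. Qed.

Let defectG x y : '[x, y] = '[D x, D y] + \sum_i '[TG i x, TG i y].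
Proof.
pose P o := if o is Some i then T i else D0.
rewrite (@lmap_parseval R H H _ P) ?sum_option // => u v.
by rewrite sum_option !D0E dotZl dotZr Om1 mulr1 -dotC defect.
Qed.

Let lamG1 p q : \sum_i lamG p i * (lamG q i)^* %R != 1. Proof. exact: lam1. Qed.

Let io : bop G (l2 G) := coext defectG.
Let ioE x n : io x n = D (word_act TG (heap_word d n) x).
Proof. exact: coextE. Qed.
Let io_isom x y : '[io x, io y] = '[x, y].
Proof. exact: (coext_isometry kapGT defectG TkapG lamG1). Qed.
Let bshift_io i x : bshift i (io x) = io (TG i x).
Proof. exact: bshift_coext. Qed.

Local Notation BW := (word_act (fun i : 'I_d.+1 => @bshift R d G i)).
Local Notation TW := (word_act TG).
Local Notation LW := (@fshift_word R d G).

Let BW_io w x : BW w (io x) = io (TW w x).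
Proof. by elim: w x => [//|i w IH] x; rewrite /word_act /= bshift_io; exact: IH. Qed.

Section Invariant.
Variables (k : nat) (x : 'I_k -> G).

(** [N] is the closed invariant subspace of the Fock space generated by the
    [io (x j)], and [N1] the part of it reached by nonempty words, that is, the
    sum of the [fshift i N]; both as double orthogonal complements. *)
Let S (g : l2 G) := exists w j, g = LW w (io (x j)).
Let S1 (g : l2 G) := exists i w j, g = LW (i :: w) (io (x j)).
Let N (f : l2 G) := forall g, (forall s, S s -> '[g, s] = 0) -> '[f, g] = 0.
Let N1 (f : l2 G) := forall g, (forall s, S1 s -> '[g, s] = 0) -> '[f, g] = 0.

Let N_sub : is_subspace N.
Proof.
split=> [g _|a f f' Nf Nf' g h]; first exact: dot0l.
by rewrite dotDl dotZl Nf // Nf' // mulr0 addr0.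
Qed.
Let NB f g : N f -> N g -> N (f - g).
Proof.
move=> Nf Ng; rewrite addrC -scaleN1r; have [_ h] := N_sub; exact: h.
Qed.
Let N_S f : S f -> N f.
Proof. by move=> Sf g h; rewrite dotC h ?rmorph0. Qed.
Let N1_N f : N1 f -> N f.
Proof. by move=> N1f g h; apply: N1f => _ [i [w [j ->]]]; apply: h; exists (i :: w), j. Qed.
Let N_fshift (i : 'I_d.+1) f : N f -> N1 (fshift i f).
Proof.
move=> Nf g h; rewrite dot_fshiftl; apply: Nf => _ [w [j ->]].
by rewrite -dot_fshiftr; apply: h; exists i, w, j.
Qed.
Let N1_bshift (i : 'I_d.+1) f : N1 f -> N (bshift i f).
Proof.
move=> N1f g h; rewrite -dot_fshiftr; apply: N1f => _ [l [w [j ->]]].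
rewrite dot_fshiftl bshift_fshift; case: ifP => _; last exact: dot0r.
by apply: h; exists w, j.
Qed.
Let N1_0 f : N1 f -> f 0%N = 0.
Proof.
move=> N1f; apply: dot_ext => g; rewrite dot0l -dot_single; apply: N1f => _ [i [w [j ->]]].
by rewrite dotC dot_single fshift0 dot0l rmorph0.
Qed.
Let N_LW w f : N f -> N (LW w f).
Proof. by move=> Nf; elim: w => [//|i w IH]; apply/N1_N/N_fshift. Qed.

(* A generator modulo N1 is its projection on the wandering space of N. *)
Let wander j : exists u : l2 G, N1 (io (x j) - u) /\ forall s, S1 s -> '[u, s] = 0.
Proof.
have [p [pN pS]] := perp_decomp S1 (io (x j)).
by exists (io (x j) - p); split=> //; rewrite opprB addrC subrK.
Qed.

(** The wandering space of [N], the orthogonal complement of [N1] in [N], is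
    spanned by the projections of the [k] generators, so it has an orthonormal
    basis [e a] with [s <= k] elements, and the translates of the [e a] by words
    form an orthonormal basis of [N]. Let [C] be the map that sends a vector to
    its coefficients in this basis. It commutes with the backward shifts, so
    that it maps an eigenvector [io (kapG p)] to a combination of eigenvectors
    with the same eigenvalue; hence [C] leaves the range of [io] invariant and
    restricts to a contraction [Th] of [l2 H] with values supported on the first
    [s] entries. As [C] is isometric on [N], [Th] preserves the inner products
    with the [x j]. The third conclusion is this identity for the multiplication
    operators [M], tested on eigenvectors. The last one is cyclicity of the
    vectors [Th (x j)]: a vector [g] orthogonal to their orbits gives the vector
    [adj C (io g)] of [N], which is orthogonal to the generators of [N]. *)
Theorem inner_factor : exists (s : nat) (Th : bop G G), [/\ (s <= k)%N,
    forall y : G, n2 (Th y) <= n2 y,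
    forall (M : bop G G) (u : Z -> R[i]),
      (forall (h : G) n v, '[M h, single n (kap v)] = u v * '[h, single n (kap v)]) ->
      forall j, M (x j) = adj Th (M (Th (x j))),
    forall (y : G) n, (s <= n)%N -> Th y n = 0
  & forall g : G, (forall n, (s <= n)%N -> g n = 0) ->
      (forall w j, '[TW w g, Th (x j)] = 0) -> g = 0].
Proof.
have /choice[u0 u0P] := wander.
pose u n := if insub n is Some j then u0 j else 0.
have uP (j : 'I_k) : u j = u0 j by rewrite /u valK.
have [s [e [sk eO eP eU]]] := @gram_schmidt R (l2 G) k u.
exists s.
(* a subspace that contains the projected generators contains the e a *)
have eW a : (a < s)%N -> N (e a) /\ forall z, S1 z -> '[e a, z] = 0.
  apply: (eP (fun z => N z /\ forall t, S1 t -> '[z, t] = 0)).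
    split; first by split=> [|t _]; [exact: N_sub.1|exact: dot0l].
    move=> c y z [Ny yS] [Nz zS]; split; first exact: N_sub.2.
    by move=> t St; rewrite dotDl dotZl yS // zS // mulr0 addr0.
  move=> j jk; rewrite (uP (Ordinal jk)).
  have [h1 h2] := u0P (Ordinal jk); split=> //.
  rewrite -[u0 _](subKr (io (x (Ordinal jk)))); apply: NB; last exact: N1_N.
  by apply: N_S; exists [::], (Ordinal jk).
have eN a : (a < s)%N -> N (e a) by move=> /eW[].
have eN1 a f : (a < s)%N -> N1 f -> '[f, e a] = 0.
  by move=> /eW[_ h] N1f; apply: N1f.
(* The class of such f is invariant under backward shifts, because f is in N1;
   and elements of N1 have no entry at the empty word. *)
have complete f : N f -> (forall a w, (a < s)%N -> '[f, LW w (e a)] = 0) -> f = 0.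
  move=> Nf fe; apply: l2_ext => m; rewrite l2_0.
  elim/ltn_ind: m f Nf fe => m IH f Nf fe.
  have N1f : N1 f.
    have [p [pN pS]] := perp_decomp S1 f.
    suff -> : f = p by [].
    apply/eqP; rewrite -subr_eq0; apply/eqP/n2_eq0.
    have N1p : N1 p by [].
    rewrite /n2 (_ : '[_, _] = 0) //.
    have Nfp : N (f - p) by apply: NB => //; exact: N1_N.
    apply: Nfp => _ [w [j ->]].
    case: w => [|i w]; last by apply: pS; exists i, w, j.
    have [h1 h2] := u0P j.
    rewrite -[LW _ _]/(io (x j)) -[io (x j)](subrK (u0 j)) dotDr [X in X + _]dotC h1 ?rmorph0 ?add0r; last exact: pS.
    rewrite dotBl -uP (eU f) ?sub0r // => [|a sa]; last exact: (fe a [::]).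
    by rewrite uP N1p ?oppr0.
  have [->|[n [i mE]]] := heapP d m; first exact: N1_0.
  rewrite mE -bshiftE; apply: IH => [||a w sa].
  - by rewrite mE ltnS; apply: leq_trans (leq_addr _ _); rewrite leq_pmulr.
  - exact: N1_bshift.
  - by rewrite -dot_fshiftr; exact: (fe a (i :: w)).
have LWc i w f : LW (i :: w) f = fshift i (LW w f) by [].
have LWO a b w w' : (a < s)%N -> (b < s)%N ->
    '[LW w (e a), LW w' (e b)] = ((w == w') && (a == b))%:R.
  move=> sa sb; elim: w w' => [|i w IH] [|i' w'].
  - exact: eO.
  - by rewrite dotC eN1 ?rmorph0 //; apply: N_fshift; apply: N_LW; exact: eN.
  - by rewrite eN1 //; apply: N_fshift; apply: N_LW; exact: eN.
  - rewrite [LW _ _]LWc [in X in '[_, X]]LWc dot_fshiftl bshift_fshift eqseq_cons.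
    by case: eqP => _; rewrite ?IH ?dot0r.
(* the coefficients at the word w, as a combination of constants in l2 H *)
pose cf w (f : l2 G) : G := \sum_(a < s) '[f, LW w (e a)] *: single a Om.
have cfE w f b : cf w f b = if (b < s)%N then '[f, LW w (e b)] *: Om else 0.
  rewrite /cf l2_sum; case: ltnP => sb.
    rewrite (bigD1 (Ordinal sb)) //= l2Z singleE eqxx big1 ?addr0 // => a ab.
    rewrite l2Z singleE; case: eqP => [ba|_]; last exact: scaler0.
    by case/negP: ab; apply/eqP/val_inj.
  rewrite big1 // => a _; rewrite l2Z singleE; case: eqP => [ba|_]; last exact: scaler0.
  by have := ltn_ord a; rewrite -ba ltnNge sb.
have cfL w : linear (cf w).
  move=> c f g; apply: l2_ext => b; rewrite l2D l2Z !cfE.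
  by case: ifP => _; rewrite ?scaler0 ?addr0 // dotDl dotZl scalerDl scalerA.
have n2Om : n2 Om = 1 by rewrite /n2 Om1.
have cf_n2 w f : n2 (cf w f) = \sum_(a < s) normc '[f, LW w (e a)] ^+ 2.
  rewrite /n2 (_ : '[_, _] = (\sum_(a < s) normc '[f, LW w (e a)] ^+ 2)%:C) //.
  rewrite {2}/cf dot_sumr rmorph_sum; apply: eq_bigr => a _.
  by rewrite dotZr dot_single cfE ltn_ord dotZl Om1 mulr1 mulrC -normc_sqr.
have [C [CE Cle]] : exists C : bop (l2 G) (l2 G),
    (forall f n, C f n = cf (heap_word d n) f) /\ forall f, n2 (C f) <= 1 * n2 f.
  apply: (@l2_bop R (l2 G) G (fun f n => cf (heap_word d n) f) 1) => [n|f n].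
    exact: cfL.
  rewrite mul1r; under eq_bigr do rewrite cf_n2.
  rewrite big_mkord pair_bigA /=.
  apply: (@bessel R (l2 G) _ (fun p : 'I_n * 'I_s => LW (heap_word d p.1) (e p.2))).
  move=> [m a] [m' a'] /=; rewrite LWO //; congr _%:R; congr nat_of_bool.
  rewrite xpair_eqE (inj_eq (@heap_word_inj d)).
  by [].
have Cb (i : 'I_d.+1) f : bshift i (C f) = C (bshift i f).
  apply: l2_ext => m; rewrite bshiftE !CE heap_wordS; apply: l2_ext => b.
  by rewrite !cfE; case: ifP => // _; rewrite /= dot_fshiftr.
have CBW w f : BW w (C f) = C (BW w f).
  by elim: w f => [//|i w IH] f; rewrite /word_act /= Cb; exact: IH.
have Cf (i : 'I_d.+1) f : N f -> C (fshift i f) = fshift i (C f).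
  move=> Nf; apply: l2_ext => n; have [->|[m [l ->]]] := heapP d n.
    rewrite fshift0 CE; apply: l2_ext => b; rewrite cfE; case: ifP => // sb.
    by rewrite (eN1 b) ?scale0r //; exact: N_fshift.
  rewrite fshiftS CE heap_wordS; apply: l2_ext => b; rewrite cfE /= dot_fshiftr bshift_fshift.
  by case: (l == i); rewrite ?CE ?cfE ?dot0l ?scale0r ?if_same ?l2_0.
have CLW w f : N f -> C (LW w f) = LW w (C f).
  by move=> Nf; elim: w => [//|i w IH]; rewrite /= Cf ?IH //; exact: N_LW.
have Ce a : (a < s)%N -> C (e a) = single 0 (single a Om).
  move=> sa; apply: l2_ext => n; rewrite CE singleE; have [->|[m [l ->]]] := heapP d n.
    rewrite eqxx; apply: l2_ext => b; rewrite cfE singleE /= [b == a]eq_sym.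
    case: ltnP => sb; first by rewrite eO //; case: eqP; rewrite ?scale1r ?scale0r.
    by rewrite (ltn_eqF (leq_trans sa sb)).
  rewrite heap_wordS; apply: l2_ext => b; rewrite cfE; case: ifP => // sb.
  rewrite dotC eN1 ?rmorph0 ?scale0r //; apply: N_fshift; apply: N_LW; exact: eN.
have dotCe f a w : (a < s)%N -> '[f, C (LW w (e a))] = '[BW w f 0%N a, Om].
  by move=> sa; rewrite CLW ?Ce ?dot_fshift_wordr ?dot_single //; exact: eN.
have CS f : (forall z, S z -> '[f, z] = 0) -> C f = 0.
  move=> h; apply: l2_ext => n; rewrite CE; apply: l2_ext => b; rewrite cfE.
  case: ifP => // sb; rewrite dotC (N_LW _ (eN _ sb)) ?rmorph0 ?scale0r //.
have adjC_N g : N (adj C g) by move=> h hS; rewrite adjPl CS // dot0r.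
have parseval f : N f -> adj C (C f) = f.
  move=> Nf; apply/esym/eqP; rewrite -subr_eq0; apply/eqP; apply: complete.
    exact: NB.
  move=> a w sa; rewrite dotBl adjPl dotCe // CBW CE cfE sa dotZl Om1 mulr1.
  by rewrite /= -dot_fshift_wordr subrr.
pose Th := bcomp (adj io) (bcomp C io).
(* the eigenvalue of the word w at the point v *)
pose lw w v := foldl (fun c i => lam v i * c) (1 : R[i]) w.
have TWz w v (z : G) : (forall i, TG i z = lam v i *: z) -> TW w z = lw w v *: z.
  move=> hz; suff h c : TW w (c *: z) = foldl (fun c i => lam v i * c) c w *: z.
    by rewrite -[z in LHS]scale1r h.
  elim: w c => [//|i w IH] c; rewrite /word_act /= linearZ /= hz scalerA -IH.
  by rewrite /word_act mulrC.
(* by the eigenvector property, the value of Th at single n (kap v) *)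
pose gk n v : G := \sum_(a < s) '[io (single n (kap v)), e a] *: single a (kap v).
have gkT n v i : TG i (gk n v) = lam v i *: gk n v.
  rewrite /gk linear_sum scaler_sumr; apply: eq_bigr => a _.
  by rewrite linearZ /= (TkapG i (val a, v)) !scalerA mulrC.
have Cio_kap n v : C (io (single n (kap v))) = io (gk n v).
  apply: l2_ext => m; rewrite CE ioE (TWz _ _ _ (gkT n v)) linearZ /=.
  rewrite /cf /gk linear_sum scaler_sumr; apply: eq_bigr => a _.
  rewrite linearZ /= (DkapG (val a, v)) scalerA; congr (_ *: _).
  rewrite dot_fshift_wordr BW_io (TWz _ v); last by move=> i; exact: (TkapG i (n, v)).
  by rewrite linearZ dotZl.
have io_adj y : adj io (io y) = y by apply: dot_ext => z; rewrite adjPl io_isom.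
have Th_kap n v : Th (single n (kap v)) = gk n v by rewrite /Th /= Cio_kap io_adj.
have Cio y : C (io y) = io (Th y).
  apply: (@total_bop R G (l2 G) _ kapG (bcomp C io) (bcomp io Th) kapGT) => -[n v].
  by rewrite /= -/(Th _) /kapG /= Cio_kap io_adj.
have ThTh j y : '[Th (x j), Th y] = '[x j, y].
  rewrite -io_isom -!Cio -adjPl parseval ?io_isom //.
  by apply: N_S; exists [::], j.
have Th_le y : n2 (Th y) <= n2 y.
  rewrite /n2 -io_isom -Cio -[X in _ <= complex.Re X]io_isom.
  by have := Cle (io y); rewrite mul1r.
exists Th; split=> //.
- move=> M c Mc j; apply: (total_ext kapGT) => -[n v]; rewrite adjPl -[kapG _]/(single n (kap v)) Th_kap.
  rewrite Mc -ThTh Th_kap /gk !dot_sumr mulr_sumr; apply: eq_bigr => a _.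
  by rewrite !dotZr Mc mulrCA.
- move=> y n sn; apply: dot_ext => h; rewrite dot0l -dot_single adjP.
  rewrite (_ : adj Th _ = 0) ?dot0r //.
  apply: kapGT => -[m v]; rewrite adjPl -[kapG _]/(single m (kap v)) Th_kap dotC /gk dot_suml.
  rewrite big1 ?rmorph0 // => a _; rewrite dotZl dot_single singleE.
  by rewrite (gtn_eqF (leq_trans (ltn_ord a) sn)) dot0l mulr0.
- move=> g g0 gTh.
  have q0 : adj C (io g) = 0.
    apply: n2_eq0; rewrite /n2 adjC_N // => _ [w [j ->]].
    rewrite adjPl CLW; last by apply: N_S; exists [::], j.
    by rewrite dot_fshift_wordr BW_io Cio io_isom.
  suff ig : io g = 0 by apply: n2_eq0; rewrite /n2 -io_isom ig dot0l.
  apply: l2_ext => m; apply: l2_ext => b; rewrite ioE /D lmapE D0E.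
  have TWb w (y : G) : TW w y b = word_act T w (y b).
    by elim: w y => [//|i w IH] y; rewrite /word_act /= -/(TW w _) IH /TG lmapE.
  have [sb|sb] := ltnP b s; last first.
    rewrite TWb g0 // (_ : word_act T _ 0 = 0) ?dot0l ?scale0r //.
    by elim: (heap_word d m) => [//|i w IH]; rewrite /word_act /= linear0.
  have := adjPl C (LW (heap_word d m) (e b)) (io g).
  rewrite q0 dot0l dotCe // BW_io ioE /D lmapE D0E /= dotZl Om1 mulr1 => <-.
  by rewrite scale0r.
Qed.

End Invariant.
End Core.

(** * Hahn-Banach *)

(** Real linear functionals on a real subspace [S] of a complex space, dominated
    by a functional [p] that is only required to be sublinear on [S]. *)

Section HahnBanach.
Variables (R : realType) (V : lmodType R[i]) (S : set V) (p : V -> R) (v : V).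
Hypothesis S0 : S 0.
Hypothesis SP : forall (t : R) x y, S x -> S y -> S (t%:C *: x + y).
Hypothesis Sv : S v.
Hypothesis pD : forall x y, S x -> S y -> p (x + y) <= p x + p y.
Hypothesis pZ : forall (t : R) x, 0 < t -> S x -> p (t%:C *: x) = t * p x.

(** Graphs of partially defined functionals below [p] that extend
    [t v |-> t (p v)]; they are single valued because [p 0 = 0]. *)
Definition dominated_graph (A : set (V * R)) :=
  [/\ A (v, p v), forall q, A q -> S q.1 /\ q.2 <= p q.1
    & forall (t : R) q q', A q -> A q' -> A (t%:C *: q.1 + q'.1, t * q.2 + q'.2)].

Let SZ t x : S x -> S (t%:C *: x).
Proof. by move=> Sx; rewrite -[_ *: _]addr0; exact: SP. Qed.
Let SD x y : S x -> S y -> S (x + y).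
Proof. by move=> Sx Sy; rewrite -[x]scale1r; exact: SP. Qed.
Let SB x y : S x -> S y -> S (x - y).
Proof.
by move=> Sx Sy; have := SP (-1) Sy Sx; rewrite rmorphN1 scaleN1r addrC.
Qed.

Let p0 : p 0 = 0.
Proof.
have := pZ (ltr0Sn R 1) S0; rewrite scaler0; lra.
Qed.

Let pNN x : S x -> - p (- x) <= p x.
Proof.
move=> Sx; have SN : S (- x) by rewrite -sub0r; exact: SB.
have := pD Sx SN; rewrite subrr p0; lra.
Qed.

Lemma dominated_line : dominated_graph [set (t%:C *: v, t * p v) | t in [set: R]].
Proof.
split.
- by exists 1 => //; rewrite scale1r mul1r.
- move=> _ [t _ <-] /=; split; first exact: SZ.
  have [t0|t0|->] := ltrgtP t 0.
  + have := pNN (SZ t Sv); rewrite -scaleNr -rmorphN pZ ?oppr_gt0 //; lra.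
  + by rewrite pZ.
  + by rewrite mul0r scale0r p0.
- move=> t _ _ [a _ <-] [b _ <-] /=; exists (t * a + b) => //.
  by rewrite rmorphD rmorphM scalerDl scalerA mulrDl mulrA.
Qed.

(** The value [r0] at [x0] is chosen between the lower and upper bounds that
    domination imposes, which are separated by subadditivity. *)
Lemma dominated_extension (A : set (V * R)) x0 : dominated_graph A -> S x0 ->
  ~ (exists r, A (x0, r)) -> exists2 B, dominated_graph B & A `<` B.
Proof.
move=> [Av Ap AL] Sx0 nx0.
have A0 : A (0, 0).
  have := AL (-1) _ _ Av Av; rewrite rmorphN1 scaleN1r mulN1r /= !addNr; exact.
pose E := [set q.2 - p (q.1 - x0) | q in A].
have key q q' : A q -> A q' -> q.2 - p (q.1 - x0) <= p (q'.1 + x0) - q'.2.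
  move=> Aq Aq'; have [Sq _] := Ap _ Aq; have [Sq' _] := Ap _ Aq'.
  have := AL 1 _ _ Aq Aq'; rewrite scale1r mul1r => /Ap /= [_ h].
  have := pD (SB Sq Sx0) (SD Sq' Sx0); rewrite addrACA addNr addr0; lra.
have Esup : has_sup E.
  split; first by exists (0 - p (0 - x0)), (0, 0).
  by exists (p (0 + x0) - 0) => _ [q Aq <-]; exact: (key q (0, 0)).
pose r0 := sup E.
have lo q : A q -> q.2 - p (q.1 - x0) <= r0.
  by move=> Aq; apply: sup_upper_bound => //; exists q.
have hi q : A q -> r0 <= p (q.1 + x0) - q.2.
  move=> Aq; apply: sup_le_ub; first exact: Esup.1.
  by move=> _ [q' Aq' <-]; exact: key.
exists [set (q.1.1 + q.2%:C *: x0, q.1.2 + q.2 * r0) | q in A `*` [set: R]].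
  split.
  - by exists ((v, p v), 0) => //=; rewrite scale0r mul0r !addr0.
  - move=> _ [[[x r] t] /= [Aq _] <-] /=.
    have [Sx rx] := Ap _ Aq; split; first by apply: SD => //; exact: SZ.
    have sc (s : R) : A (s%:C *: x, s * r).
      by have := AL s _ _ Aq A0; rewrite /= !addr0.
    have [t0|t0|->] := ltrgtP t 0.
    + have s0 : 0 < - t by rewrite oppr_gt0.
      have := lo _ (sc (- t)^-1) => /=.
      have -> : x + t%:C *: x0 = (- t)%:C *: (((- t)^-1)%:C *: x - x0).
        by rewrite scalerBr scalerA -rmorphM /= mulfV ?gt_eqF // scale1r rmorphN scaleNr opprK.
      rewrite pZ //; last by apply: SB => //; exact: SZ.
      rewrite -(ler_pM2l s0) mulrBr mulrA mulfV ?gt_eqF // mul1r; lra.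
    + have := hi _ (sc t^-1) => /=.
      have -> : x + t%:C *: x0 = t%:C *: (t^-1%:C *: x + x0).
        by rewrite scalerDr scalerA -rmorphM /= mulfV ?gt_eqF // scale1r.
      rewrite pZ //; last by apply: SD => //; exact: SZ.
      rewrite -(ler_pM2l t0) mulrBr mulrA mulfV ?gt_eqF // mul1r; lra.
    + by rewrite scale0r mul0r !addr0.
  - move=> t _ _ [[[x r] a] /= [Ax _] <-] [[[y s] b] /= [Ay _] <-] /=.
    exists ((t%:C *: x + y, t * r + s), t * a + b).
      by split=> //; exact: (AL t _ _ Ax Ay).
    congr (_, _) => /=; last by rewrite !mulrDr !mulrDl mulrA addrACA.
    by rewrite rmorphD rmorphM scalerDr scalerDl scalerA addrACA.
split; first by move=> [x r] Ax; exists ((x, r), 0) => //=; rewrite scale0r mul0r !addr0.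
move=> h; apply: nx0; exists r0; apply: h.
by exists ((0, 0), 1) => //=; rewrite scale1r mul1r !add0r.
Qed.

Theorem hahn_banach : exists l : V -> R,
  [/\ forall (t : R) x y, S x -> S y -> l (t%:C *: x + y) = t * l x + l y,
      forall x, S x -> l x <= p x & l v = p v].
Proof.
(* the empty graph is admitted as the union of the empty chain *)
pose P (A : set (V * R)) := A = set0 \/ dominated_graph A.
have [|A [PA Amax]] := @Zorn_bigcup _ P.
  move=> F FP Ftot.
  have [[A0 FA0 nA0]|h] := pselect (exists2 A, F A & A !=set0); last first.
    left; apply/seteqP; split=> // q [A FA Aq].
    by case: h; exists A => //; exists q.
  have FG A q : F A -> A q -> dominated_graph A.
    by move=> FA Aq; have [e|//] := FP _ FA; rewrite e in Aq.
  right; split.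
  - by have [q Aq] := nA0; have [h _ _] := FG _ _ FA0 Aq; exists A0.
  - by move=> q [A FA Aq]; have [_ h _] := FG _ _ FA Aq; exact: h.
  - move=> t q q' [A FA Aq] [A' FA' Aq'].
    have [AA'|A'A] := Ftot _ _ FA FA'.
      exists A' => //; have [_ _ h] := FG _ _ FA' Aq'; apply: h => //; exact: AA'.
    exists A => //; have [_ _ h] := FG _ _ FA Aq; apply: h => //; exact: A'A.
have GA : dominated_graph A.
  case: PA => // A0; exfalso.
  apply: (Amax _ _ (or_intror dominated_line)); rewrite A0; split=> // h.
  by have [Lv _ _] := dominated_line; exact: (h _ Lv).
have [Av Ap AL] := GA.
have A0 : A (0, 0).
  have := AL (-1) _ _ Av Av; rewrite rmorphN1 scaleN1r mulN1r /= !addNr; exact.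
have Aex x : exists r, S x -> A (x, r).
  have [Sx|nSx] := pselect (S x); last by exists 0.
  have [[r Ar]|h] := pselect (exists r, A (x, r)); first by exists r.
  have [B GB AB] := dominated_extension GA Sx h.
  by case: (Amax B AB); right.
have /choice[l lA] := Aex.
have Auniq x r s : A (x, r) -> A (x, s) -> r = s.
  have half a b : A (x, a) -> A (x, b) -> a - b <= 0.
    move=> Aa Ab; have := AL (-1) _ _ Ab Aa; rewrite rmorphN1 scaleN1r mulN1r /= addNr.
    by move=> /Ap /= [_]; rewrite p0; lra.
  by move=> Ar As; have := half _ _ Ar As; have := half _ _ As Ar; lra.
exists l; split.
- move=> t x y Sx Sy; apply: (Auniq (t%:C *: x + y)); first by apply: lA; exact: SP.
  exact: (AL t _ _ (lA _ Sx) (lA _ Sy)).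
- by move=> x Sx; have [] := Ap _ (lA _ Sx).
- exact: (Auniq v _ _ (lA _ Sv) Av).
Qed.

End HahnBanach.

(** * Trace class functionals *)

Section Pairing.
Variables (R : realType) (K : hilbert R).
Implicit Types (x y : l2 K) (T : K -> K).

Lemma normc_le_ReIm (z : R[i]) : normc z <= `|complex.Re z| + `|complex.Im z|.
Proof.
case: z => a b /=; rewrite -(@ler_pXn2r _ 2) ?nnegrE ?sqrtr_ge0 ?addr_ge0 //.
rewrite sqr_sqrtr ?addr_ge0 ?sqr_ge0 // sqrrD !real_normK ?num_real //.
have := mulr_ge0 (normr_ge0 a) (normr_ge0 b); lra.
Qed.

Lemma sums_to_limn (u : nat -> R[i]) s : sums_to u s ->
  limn (series (u : nat -> (R[i])^o)) = s.
Proof.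
move=> [h1 h2]; apply: cvg_lim; first exact: norm_hausdorff.
apply/cvgrPdist_lt => e e0.
have [re0 ime] : 0 < complex.Re e /\ complex.Im e = 0.
  by move: e0; rewrite ltcE /= => /andP[/eqP -> ->].
have e2 : 0 < complex.Re e / 2 by lra.
have [N1 _ H1] := (iffLR (cvgrPdist_lt _ _) h1 _ e2).
have [N2 _ H2] := (iffLR (cvgrPdist_lt _ _) h2 _ e2).
exists (maxn N1 N2) => // n /=; rewrite geq_max => /andP[n1 n2].
have -> : e = (complex.Re e)%:C by case: (e) ime => ? ? /= ->.
rewrite -normcC ltcR; apply: le_lt_trans (normc_le_ReIm _) _.
have := H1 n n1; have := H2 n n2; rewrite !raddfB /= /series /= !raddf_sum /=; lra.
Qed.

(** The trace of [T A] for [A] the sum of the rank one operators [<., y n> x n];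
    for bounded [T] this is a vector functional of the infinite amplification of
    [T]. *)
Definition pairing T x y : R[i] :=
  limn (series (fun n => '[T (x n), y n] : (R[i])^o)).

Lemma pairing_bop (A : bop K K) x y : pairing A x y = '[lmap A x, y].
Proof.
apply: sums_to_limn; apply: eq_sums_to (l2_dotE _ _) => n; by rewrite lmapE.
Qed.

Lemma opnorm_ge0 T : linear T -> (0 <= opnorm T)%E.
Proof.
move=> TL; have T0 : T 0 = 0 by have := TL (-1) 0 0; rewrite scaler0 addr0 scaleN1r addNr.
apply: ereal_sup_ubound; exists 0; first by rewrite /= hnorm0.
by rewrite T0 hnorm0.
Qed.

Lemma opnorm_scaled T C : linear T -> (opnorm T <= C%:E)%E ->
  forall x : K, hnorm (T x) <= C * hnorm x.
Proof.
move=> TL TC x; have T0 : T 0 = 0 by have := TL (-1) 0 0; rewrite scaler0 addr0 scaleN1r addNr.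
have TZ a z : T (a *: z) = a *: T z by have := TL a z 0; rewrite T0 !addr0.
have [->|x0] := eqVneq x 0; first by rewrite T0 hnorm0 mulr0.
have nx : 0 < hnorm x.
  rewrite lt_def hnorm_ge0 andbT; apply: contra_neq x0; exact: hnorm_eq0.
have : ((hnorm (T ((hnorm x)^-1%:C *: x)))%:E <= C%:E)%E.
  apply: le_trans TC; apply: ereal_sup_ubound.
  exists ((hnorm x)^-1%:C *: x) => //=.
  by rewrite hnormZ normcR ger0_norm ?invr_ge0 ?hnorm_ge0 // mulVf ?gt_eqF.
rewrite lee_fin TZ hnormZ normcR ger0_norm ?invr_ge0 ?hnorm_ge0 //.
by rewrite ler_pdivrMl // mulrC.
Qed.

Lemma opnorm_le T C : 0 <= C -> (forall x : K, hnorm (T x) <= C * hnorm x) -> (opnorm T <= C%:E)%E.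
Proof.
move=> C0 h; apply: ge_ereal_sup => _ [x /= x1 <-]; rewrite lee_fin.
by apply: le_trans (h x) _; rewrite -[leRHS]mulr1 ler_wpM2l.
Qed.

Lemma opnorm_bound T : linear T -> (opnorm T < +oo)%E ->
  exists2 C, 0 <= C & forall x : K, hnorm (T x) <= C * hnorm x.
Proof.
move=> TL Tf; have T0 := opnorm_ge0 TL.
exists (fine (opnorm T)); first exact: fine_ge0.
by apply: opnorm_scaled => //; rewrite fineK // ge0_fin_numE.
Qed.

Lemma bounded_bop T : bounded_op T -> exists A : bop K K, T = A.
Proof.
by move=> [TL /(opnorm_bound TL) h]; exists (Bop TL h).
Qed.

Lemma opnorm_le1 T : (forall x : K, hnorm (T x) <= hnorm x) -> (opnorm T <= 1)%E.
Proof. by move=> h; apply: opnorm_le => // x; rewrite mul1r. Qed.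

Lemma opnorm_le1P T : linear T -> (opnorm T <= 1)%E -> forall x : K, hnorm (T x) <= hnorm x.
Proof. by move=> TL h x; have := opnorm_scaled TL h x; rewrite mul1r. Qed.

Lemma bop_bounded (A : bop K K) : bounded_op A.
Proof.
split; first exact: bop_lin.
have [C C0 hC] := bop_bnd A.
by apply: le_lt_trans (opnorm_le C0 hC) _; rewrite ltry.
Qed.

Lemma pairing_lin T T' a x y : bounded_op T -> bounded_op T' ->
  pairing (a *: T + T') x y = a * pairing T x y + pairing T' x y.
Proof.
move=> /bounded_bop[A ->] /bounded_bop[B ->]; rewrite !pairing_bop.
apply: sums_to_limn; apply: eq_sums_to (sums_toP a (l2_dotE (lmap A x) y) (l2_dotE (lmap B x) y)) => n.
by rewrite !lmapE -dotZl -dotDl.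
Qed.

(** The shifts for two letters have orthogonal ranges and commute with
    amplifications, so a sum of two pairings is a pairing. *)
Definition interleave x y : l2 K := @fshift R 1 K ord0 x + @fshift R 1 K ord_max y.

Lemma dot_interleave x y x' y' : '[interleave x y, interleave x' y'] = '[x, x'] + '[y, y'].
Proof.
have n01 : (ord0 == ord_max :> 'I_2) = false by [].
rewrite /interleave !dotDl !dotDr !dot_fshiftl !bshift_fshift n01 eq_sym n01.
by rewrite !eqxx !dot0r addr0 add0r.
Qed.

Lemma n2_interleave x y : n2 (interleave x y) = n2 x + n2 y.
Proof. by rewrite /n2 dot_interleave raddfD. Qed.

Lemma pairing_interleave T x y x' y' : bounded_op T ->
  pairing T (interleave x x') (interleave y y') = pairing T x y + pairing T x' y'.
Proof.
move=> /bounded_bop[A ->]; rewrite !pairing_bop -dot_interleave; congr '[_, _].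
by rewrite /interleave raddfD /= !lmap_fshift.
Qed.

Lemma pairingZ T a b x y : bounded_op T ->
  pairing T (a *: x) (b *: y) = a * (b^* )%R * pairing T x y.
Proof.
move=> /bounded_bop[A ->]; rewrite !pairing_bop.
have -> : lmap A (a *: x) = a *: lmap A x by exact: linearZ.
by rewrite dotZl dotZr mulrA.
Qed.

Lemma pairing_zero x y : pairing (0 : K -> K) x y = 0.
Proof.
rewrite -(dot0l y); apply: sums_to_limn.
by apply: eq_sums_to (l2_dotE 0 y) => n; rewrite !dot0l.
Qed.

Lemma pairing0 T : bounded_op T -> pairing T 0 0 = 0.
Proof. by move=> /bounded_bop[A ->]; rewrite pairing_bop dot0r. Qed.

Lemma pairing_single T n (x y : K) : bounded_op T ->
  pairing T (single n x) (single n y) = '[T x, y].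
Proof.
by move=> /bounded_bop[A ->]; rewrite pairing_bop lmap_single dot_single singleE eqxx.
Qed.

End Pairing.

(** [B] is assumed to contain every bounded operator that is annihilated by the
    finite rank functionals that annihilate [B]. *)

Section Predual.
Variables (R : realType) (K : hilbert R) (B : set (K -> K)).
Hypothesis Bbd : forall T, B T -> bounded_op T.
Hypothesis Bclosed : forall T : bop K K,
  (forall n (x y : 'I_n -> K),
    (forall S, B S -> \sum_i '[S (x i), y i] = 0) -> \sum_i '[T (x i), y i] = 0) -> B T.

Definition represents (phi : (K -> K) -> R[i]) (x y : l2 K) :=
  forall T, B T -> phi T = pairing T x y.

Let V : lmodType R[i] := ((K -> K) -> R[i]^o).

Let S : set V := [set psi | exists x y, represents psi x y].

Let rep_lin (a : R[i]) (psi psi' : V) x y x' y' :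
  represents psi x y -> represents psi' x' y' ->
  represents (a *: psi + psi') (interleave (a *: x) x') (interleave y y').
Proof.
move=> h h' T BT; rewrite pairing_interleave; last exact: Bbd.
have := pairingZ a 1 x y (Bbd BT).
rewrite scale1r rmorph1 mulr1 => ->.
by rewrite -h // -h'.
Qed.

Let S0 : S 0.
Proof.
by exists 0, 0 => T BT; rewrite pairing0 //; exact: Bbd.
Qed.

Let SC (a : R[i]) psi psi' : S psi -> S psi' -> S (a *: psi + psi').
Proof.
move=> [x [y h]] [x' [y' h']]; exists (interleave (a *: x) x'), (interleave y y').
exact: rep_lin.
Qed.
Let SP (t : R) psi psi' : S psi -> S psi' -> S (t%:C *: psi + psi').
Proof. exact: SC. Qed.
Let SZ a psi : S psi -> S (a *: psi).
Proof. by move=> h; rewrite -[_ *: _]addr0; exact: SC. Qed.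

Let costs (psi : V) : set R :=
  [set r | exists x y, represents psi x y /\ r = (n2 x + n2 y) / 2].

(** The quotient trace norm of a functional on [B], as the infimum of
    [(n2 x + n2 y) / 2] over its representations; it is a seminorm because
    representations can be interleaved. *)
Let q (psi : V) : R := inf (costs psi).

Let costs_inf psi : S psi -> has_inf (costs psi).
Proof.
move=> [x [y h]]; split; first by exists ((n2 x + n2 y) / 2), x, y.
exists 0 => _ [x' [y' [_ ->]]]; have := n2_ge0 x'; have := n2_ge0 y'; lra.
Qed.

Let q_le psi x y : represents psi x y -> q psi <= (n2 x + n2 y) / 2.
Proof.
move=> h; apply: ge_inf; last by exists x, y.
by apply: (proj2 (costs_inf _)); exists x, y.
Qed.

Let q_ge psi c : S psi -> (forall x y, represents psi x y -> c <= (n2 x + n2 y) / 2) ->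
  c <= q psi.
Proof.
move=> Sp h; apply: lb_le_inf; first exact: (costs_inf Sp).1.
by move=> _ [x [y [r ->]]]; exact: h.
Qed.

Let qD psi psi' : S psi -> S psi' -> q (psi + psi') <= q psi + q psi'.
Proof.
move=> Sp Sp'; rewrite -lerBlDr; apply: q_ge => // x y h.
rewrite lerBlDr -lerBlDl; apply: q_ge => // x' y' h'.
rewrite lerBlDl; have := rep_lin 1 h h'; rewrite !scale1r => /q_le.
rewrite !n2_interleave; lra.
Qed.

Let qZ_le (t : R) psi : 0 < t -> S psi -> q (t%:C *: psi) <= t * q psi.
Proof.
move=> t0 Sp; rewrite -ler_pdivrMl //; apply: q_ge => // x y h.
rewrite ler_pdivrMl //.
have st : 0 <= Num.sqrt t by exact: sqrtr_ge0.
have sq : Num.sqrt t ^+ 2 = t by rewrite sqr_sqrtr // ltW.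
have : represents (t%:C *: psi) ((Num.sqrt t)%:C *: x) ((Num.sqrt t)%:C *: y).
  move=> T BT; rewrite pairingZ; last exact: Bbd.
  rewrite -h // [X in _ * X * _](conjc_real (Num.sqrt t)) -rmorphM -expr2 sq.
  by [].
by move=> /q_le; rewrite !n2Z normcR ger0_norm // sq; lra.
Qed.

Let qZ (t : R) psi : 0 < t -> S psi -> q (t%:C *: psi) = t * q psi.
Proof.
move=> t0 Sp; apply/eqP; rewrite eq_le qZ_le //=.
rewrite -ler_pdivlMl //; apply: le_trans (qZ_le (t := t^-1) _ (SZ t%:C Sp)).
  by rewrite scalerA -rmorphM /= mulVf ?gt_eqF // scale1r.
by rewrite invr_gt0.
Qed.

(** For positive [a] and [b] the value [s = b / a] gives the bound. *)
Lemma amgm_limit (r a b : R) : 0 <= a -> 0 <= b ->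
  (forall s, 0 < s -> r <= (s * a ^+ 2 + s^-1 * b ^+ 2) / 2) -> r <= a * b.
Proof.
move=> a0 b0 h; apply/ler_addgt0Pr => e e0.
(* [s = (b + f) / (a + f)] for a small [f] avoids the division by zero *)
pose f := Num.min 1 (e / (a + b + 1)).
have ab : 0 < a + b + 1 by lra.
have f0 : 0 < f by rewrite lt_min ltr01 divr_gt0.
have fe : f * (a + b + 1) <= e by rewrite -ler_pdivlMr // ge_min lexx orbT.
have af : 0 < a + f by lra.
have bf : 0 < b + f by lra.
have := h ((b + f) / (a + f)) (divr_gt0 bf af).
have -> : (b + f) / (a + f) * a ^+ 2 = (b + f) * a * (a / (a + f)).
  by field; rewrite gt_eqF.
have -> : ((b + f) / (a + f))^-1 * b ^+ 2 = (a + f) * b * (b / (b + f)).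
  by field; rewrite !gt_eqF.
have h1 : (b + f) * a * (a / (a + f)) <= (b + f) * a.
  by apply: ler_piMr; [exact: mulr_ge0 (ltW bf) a0|rewrite ler_pdivrMr //; lra].
have h2 : (a + f) * b * (b / (b + f)) <= (a + f) * b.
  by apply: ler_piMr; [exact: mulr_ge0 (ltW af) b0|rewrite ler_pdivrMr //; lra].
have : f * a <= f * (a + b + 1) by rewrite ler_pM2l //; lra.
have : f * b <= f * (a + b + 1) by rewrite ler_pM2l //; lra.
lra.
Qed.

Definition l2_tail (N : nat) (x : l2 K) : l2 K :=
  x - \sum_(n < N) single n (x n).

Lemma l2_tailE N x m : l2_tail N x m = if (m < N)%N then 0 else x m.
Proof.
rewrite /l2_tail l2D l2N l2_sum; case: ltnP => mN.
  rewrite (bigD1 (Ordinal mN)) //= singleE eqxx big1 ?addr0 ?subrr // => n nm.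
  by rewrite singleE; case: eqP => // e; case/negP: nm; apply/eqP/val_inj.
rewrite big1 ?subr0 // => n _; rewrite singleE; case: eqP => // e.
by have := ltn_ord n; rewrite -e ltnNge mN.
Qed.

Lemma dot_l2_tail N x y :
  '[l2_tail N x, l2_tail N y] = '[x, y] - \sum_(n < N) '[x n, y n].
Proof.
rewrite {2}/l2_tail dotBr dot_sumr [X in _ - X]big1 ?subr0 => [|n _]; last first.
  by rewrite dot_single l2_tailE ltn_ord dot0l.
rewrite /l2_tail dotBl dot_suml; congr (_ - _); apply: eq_bigr => n _.
by rewrite dotC dot_single -dotC.
Qed.

Lemma lmap_l2_tail N (A : bop K K) x : lmap A (l2_tail N x) = l2_tail N (lmap A x).
Proof.
by apply: l2_ext => m; rewrite lmapE !l2_tailE; case: ifP; rewrite ?lmapE ?linear0.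
Qed.

Lemma n2_l2_tail_cvg x : n2 (l2_tail N x) @[N --> \oo] --> (0 : R).
Proof.
have -> : (fun N => n2 (l2_tail N x)) = (fun N => n2 x - series (fun n => n2 (x n)) N).
  apply/funext => N; rewrite /n2 dot_l2_tail raddfB raddf_sum /series /=.
  by rewrite big_mkord.
rewrite -[X in _ --> X](subrr (n2 x)); apply: cvgB; first exact: cvg_cst.
exact: (l2_dotE x x).1.
Qed.

Section Extremal.
Variable phi : V.
Hypothesis Sphi : S phi.

(** Hahn-Banach duality of the predual of [B]: a functional [L] below the norm
    [q] and equal to it at [phi] is given by an operator [T], through
    ['[T x, y] = L (rho x y)] for the rank one functionals [rho x y]. [T] is in
    [B] because [L psi] only depends on the values of [psi] on [B], and
    [phi T = L phi] because [phi] is the [q]-limit of finite sums of rank one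
    functionals. *)
Lemma norming_operator : exists T : bop K K,
  [/\ B T, forall x, hnorm (T x) <= hnorm x & complex.Re (phi T) = q phi].
Proof.
have [l [lL lq lphi]] := @hahn_banach R V S q phi S0 SP Sphi qD qZ.
have l_eq psi psi' : S psi -> S psi' -> (forall T, B T -> psi T = psi' T) -> l psi = l psi'.
  have half u w : S u -> S w -> (forall T, B T -> u T = w T) -> l u - l w <= 0.
    move=> Su Sw uw.
    rewrite addrC -mulN1r -(lL (-1) w u Sw Su) rmorphN1 scaleN1r.
    have r0 : represents (- w + u) 0 0.
      move=> T BT; rewrite pairing0; last exact: Bbd.
      rewrite -[(- w + u) T]/(- w T + u T) uw // addNr.
      by [].
    apply: le_trans (lq _ _) _; first by exists 0, 0.
    by apply: le_trans (q_le r0) _; rewrite n20 addr0 mul0r.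
  move=> Su Sw h; apply/eqP; rewrite eq_le -subr_le0 half //= -subr_le0 half //.
  by move=> T BT; rewrite h.
(* the complexification of l *)
pose L (psi : V) : R[i] := Complex (l psi) (- l ('i *: psi)).
have l0 : l 0 = 0.
  have := lL 1 0 0 S0 S0; rewrite scaler0 addr0; lra.
have lZ (t : R) psi : S psi -> l (t%:C *: psi) = t * l psi.
  by move=> Su; have := lL t psi 0 Su S0; rewrite l0 !addr0.
have lD psi psi' : S psi -> S psi' -> l (psi + psi') = l psi + l psi'.
  by move=> Su Sw; have := lL 1 _ _ Su Sw; rewrite scale1r mul1r.
have lC a psi : S psi -> l (a *: psi) = complex.Re a * l psi + complex.Im a * l ('i *: psi).
  move=> Su; rewrite {1}[a]complexE scalerDl lD; try exact: SZ.
  by rewrite lZ // ['i%C * _]mulrC -scalerA lZ //; exact: SZ.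
have LL a psi psi' : S psi -> S psi' -> L (a *: psi + psi') = a * L psi + L psi'.
  move=> Su Sw; rewrite /L scalerDr !lD; try (by do ?apply: SZ).
  rewrite scalerA (lC a) // (lC ('i%C * a)) //; case: a => s t /=.
  by apply/eqP; rewrite eq_complex /=; apply/andP; split; apply/eqP; ring.
have L_eq psi psi' : S psi -> S psi' -> (forall T, B T -> psi T = psi' T) -> L psi = L psi'.
  move=> Su Sw h; rewrite /L (l_eq _ _ Su Sw h); congr (Complex _ (- _)).
  by apply: l_eq; [exact: SZ|exact: SZ|move=> T BT; rewrite -[LHS]/('i * psi T) h].
pose rho x y : V := fun T => '[T x, y].
have rho_rep x y : represents (rho x y) (single 0 x) (single 0 y).
  by move=> T BT; rewrite pairing_single //; exact: Bbd.
have Srho x y : S (rho x y) by exists (single 0 x), (single 0 y).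
have n2s (x : K) : n2 (single 0%N x) = n2 x.
  by rewrite /n2 dot_single singleE eqxx.
have rholin a x x' y : L (rho (a *: x + x') y) = a * L (rho x y) + L (rho x' y).
  rewrite -LL //; apply: L_eq => //; first exact: SC.
  move=> T BT; have [A ->] := bounded_bop (Bbd BT).
  by rewrite /rho linearP dotDl dotZl.
have rhoZr a x y : L (rho x (a *: y)) = (a^* )%R * L (rho x y).
  have := LL (a^* )%R (rho x y) 0 (Srho x y) S0.
  have -> : L 0 = 0 by rewrite /L scaler0 l0 oppr0.
  rewrite !addr0 => <-; apply: L_eq => //; first exact: SZ.
  by move=> T BT; rewrite /rho dotZr.
have rhoD x y y' : L (rho x (y + y')) = L (rho x y) + L (rho x y').
  have := LL 1 _ _ (Srho x y) (Srho x y'); rewrite mul1r => <-; apply: L_eq => //; first exact: SC.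
  by move=> T BT; rewrite scale1r /rho dotDr.
have rhobound x y : normc (L (rho x y)) <= hnorm x * hnorm y.
  have [->|z0] := eqVneq (L (rho x y)) 0; first by rewrite Normc.normc0 mulr_ge0 ?hnorm_ge0.
  apply: amgm_limit => [||s s0]; [exact: hnorm_ge0|exact: hnorm_ge0|].
  pose z := L (rho x y); pose c := (normc z)%:C / z.
  have zn : normc z != 0.
    by apply: contra_neq z0 => /Normc.eq0_normc.
  have c1 : normc c = 1.
    by rewrite /c Normc.normcM Normc.normcV normcR ger0_norm ?normc_ge0 // mulfV.
  have sc (t : R) u : n2 (t%:C *: u) = t ^+ 2 * n2 u by rewrite n2Z normcR real_normK ?num_real.
  pose t := Num.sqrt s.
  have t0 : 0 < t by rewrite sqrtr_gt0.
  have st : t ^+ 2 = s by rewrite sqr_sqrtr // ltW.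
  have e : L (rho (t%:C *: (c *: x)) (t^-1%:C *: y)) = (normc z)%:C.
    rewrite rhoZr [X in X * _](conjc_real t^-1).
    have rZ a u w : L (rho (a *: u) w) = a * L (rho u w).
      have := rholin a u 0 w; rewrite addr0.
      have -> : L (rho 0 w) = 0.
        have := rholin (-1) 0 0 w; rewrite scaler0 addr0 mulN1r addNr //.
      by rewrite addr0.
    by rewrite !rZ !mulrA -rmorphM /= mulVf ?gt_eqF // mul1r /c divfK.
  have := lq _ (Srho (t%:C *: (c *: x)) (t^-1%:C *: y)).
  have -> : l (rho (t%:C *: (c *: x)) (t^-1%:C *: y)) = normc z by case: e.
  move=> h; apply: le_trans h _; apply: le_trans (q_le (rho_rep _ _)) _.
  by rewrite !n2s !sc n2Z c1 expr1n mul1r !n2E exprVn st.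
have /choice[T TP] : forall x, exists z, forall y, L (rho x y) = '[z, y].
  move=> x.
  have [a u w|u|z hz] := @riesz R K (fun y => (L (rho x y))^* %R) (hnorm x).
  - by rewrite rhoD rhoZr rmorphD rmorphM [X in X * _]conjCK.
  - by rewrite normc_conj; exact: rhobound.
  - by exists z => y; rewrite dotC -hz conjCK.
have TL : linear T.
  by move=> a x x'; apply: dot_ext => y; rewrite dotDl dotZl -!TP rholin.
have T1 x : hnorm (T x) <= hnorm x.
  have := rhobound x (T x); rewrite TP dotxx normcR ger0_norm ?n2_ge0 // -n2E.
  have [->|Tx0] := eqVneq (hnorm (T x)) 0; first by rewrite hnorm_ge0.
  by rewrite expr2 ler_pM2r // lt_def Tx0 hnorm_ge0.
have Tb : exists2 C : R, 0 <= C & forall x, hnorm (T x) <= C * hnorm x.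
  by exists 1 => // x; rewrite mul1r.
pose A := Bop TL Tb.
have BA : B A.
  apply: Bclosed => n x y h.
  have -> : \sum_i '[A (x i), y i] = L (\sum_i rho (x i) (y i)).
    have : S (\sum_i rho (x i) (y i)) /\ L (\sum_i rho (x i) (y i)) = \sum_i '[A (x i), y i].
      elim/big_rec2: _ => [|i r psi _ [Sp <-]]; first by rewrite /L scaler0 l0 oppr0.
      have := LL 1 _ _ (Srho (x i) (y i)) Sp; rewrite scale1r mul1r => ->.
      split; last by rewrite TP.
      by have := SC 1 (Srho (x i) (y i)) Sp; rewrite scale1r.
    by case.
  have -> : L (\sum_i rho (x i) (y i)) = L 0; last by rewrite /L scaler0 l0 oppr0.
  apply: L_eq => //.
    by elim/big_ind: _ => // u w Su Sw; have := SC 1 Su Sw; rewrite scale1r.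
  move=> U BU; rewrite -[RHS](h U BU).
  by elim/big_rec2: _ => // i r psi _ <-.
exists A; split=> //.
have [x [y xy]] := Sphi.
rewrite xy // pairing_bop -lphi.
(* the remainder of phi after N terms is represented by tails *)
pose tl N : V := phi - \sum_(n < N) rho (x n) (y n).
have tl_rep N : represents (tl N) (l2_tail N x) (l2_tail N y).
  move=> U BU; have [C UC] := bounded_bop (Bbd BU).
  rewrite UC pairing_bop lmap_l2_tail dot_l2_tail -pairing_bop -UC -xy //.
  have evB (u w : V) : (u - w) U = u U - w U by [].
  rewrite /tl evB; congr (_ - _).
  rewrite UC.
  elim/big_rec2: _ => // i r psi _ <-.
  by rewrite lmapE.
have sum_l N : S (\sum_(n < N) rho (x n) (y n)) /\
    l (\sum_(n < N) rho (x n) (y n)) = \sum_(n < N) complex.Re '[A (x n), y n].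
  elim/big_rec2: _ => [|i r psi _ [Sp <-]]; first by [].
  rewrite lD // -[l (rho _ _)]/(complex.Re (L (rho (x i) (y i)))) TP; split=> //.
  by have := SC 1 (Srho (x i) (y i)) Sp; rewrite scale1r.
have est N : `|l phi - \sum_(n < N) complex.Re '[A (x n), y n]| <=
    (n2 (l2_tail N x) + n2 (l2_tail N y)) / 2.
  have [SN <-] := sum_l N.
  have Stl : S (tl N) by exists (l2_tail N x), (l2_tail N y).
  have -> : l phi - l (\sum_(n < N) rho (x n) (y n)) = l (tl N).
    by rewrite addrC -mulN1r -(lL (-1) _ _ SN Sphi) rmorphN1 scaleN1r /tl addrC.
  rewrite ler_norml; apply/andP; split; last exact: le_trans (lq _ Stl) (q_le (tl_rep N)).
  rewrite lerNl -mulN1r -lZ //.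
  apply: le_trans (lq _ (SZ _ Stl)) _.
  apply: le_trans (q_le (x := - l2_tail N x) (y := l2_tail N y) _) _; last by rewrite n2N.
  move=> U BU; have := pairingZ (-1) 1 (l2_tail N x) (l2_tail N y) (Bbd BU).
  rewrite scaleN1r scale1r rmorph1 mulr1 => ->; rewrite -(tl_rep N U BU) rmorphN1.
  by [].
have c1 : \sum_(n < N) complex.Re '[A (x n), y n] @[N --> \oo] --> complex.Re '[lmap A x, y].
  have := (l2_dotE (lmap A x) y).1.
  rewrite (_ : series _ = fun N => \sum_(n < N) complex.Re '[A (x n), y n]) //.
  apply/funext => N; rewrite /series /= big_mkord; apply: eq_bigr => n _.
  by rewrite lmapE.
suff c3 : \sum_(n < N) complex.Re '[A (x n), y n] @[N --> \oo] --> l phi.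
  rewrite -(cvg_lim _ c1); last exact: norm_hausdorff.
  by apply: cvg_lim; first exact: norm_hausdorff.
apply/cvgrPdist_le => e e0.
have c2 : n2 (l2_tail N x) + n2 (l2_tail N y) @[N --> \oo] --> (0 : R).
  rewrite -[X in _ --> X]addr0; apply: cvgD; exact: n2_l2_tail_cvg.
have [N0 hN0] := cvg0_eventually c2 e0.
exists N0 => // N hN; apply: le_trans (est N) _.
have := hN0 N hN; have := n2_ge0 (l2_tail N x); have := n2_ge0 (l2_tail N y) => h1 h2.
by rewrite ger0_norm ?addr_ge0 //= => h3; lra.
Qed.

End Extremal.

(** The norm of [phi] on [B] bounds the infimum of the costs of its
    representations, by [norming_operator]; rescaling [x] and [y] by inverse
    factors then makes both norms less than [1]. *)
Theorem predual_norm phi x y : represents phi x y -> (functional_norm B phi < 1)%E ->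
  exists x' y', [/\ n2 x' < 1, n2 y' < 1 & represents phi x' y'].
Proof.
move=> h h1.
have Sphi : S phi by exists x, y.
have [T [BT T1 qT]] := norming_operator Sphi.
have q1 : q phi < 1.
  rewrite -qT -lte_fin; apply: le_lt_trans h1.
  apply: le_trans (_ : (normc (phi T))%:E <= _)%E; first by rewrite lee_fin Re_le_normc.
  apply: ereal_sup_ubound; exists T => //; split=> //.
  exact: opnorm_le1 T1.
have [_ [u [w [uw ->]]] c1] := inf_lt (proj1 (costs_inf Sphi)) q1.
pose a := hnorm u; pose b := hnorm w.
have a0 : 0 <= a by exact: hnorm_ge0.
have b0 : 0 <= b by exact: hnorm_ge0.
have ab : a * b < 1.
  move: c1; rewrite -!n2E -/a -/b; have := sqr_ge0 (a - b); lra.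
have [t [t0 ta tb]] : exists t, [/\ 0 < t, t * a < 1 & b < t].
  have [->|an] := eqVneq a 0; first by exists (b + 1); split; lra.
  have ap : 0 < a by rewrite lt_def an.
  have ba : b < a^-1 by rewrite -(ltr_pM2l ap) mulfV.
  exists ((b + a^-1) / 2).
  have ai : 0 < a^-1 by rewrite invr_gt0.
  split; [lra| |lra].
  have -> : (b + a^-1) / 2 * a = (a * b + 1) / 2 by field.
  lra.
exists (t%:C *: u), (t^-1%:C *: w); split.
- by rewrite -hnorm_lt1 hnormZ normcR gtr0_norm.
- by rewrite -hnorm_lt1 hnormZ normcR gtr0_norm ?invr_gt0 // -ltr_pdivlMl ?invr_gt0 // invrK mulr1.
- move=> U BU; rewrite pairingZ; last exact: Bbd.
  rewrite uw // [X in _ * X * _](conjc_real t^-1) -rmorphM /= mulfV ?gt_eqF //.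
  by rewrite mul1r.
Qed.

End Predual.

(** * Weak-star continuous functionals *)

Section WeakStar.
Variables (R : realType) (K : hilbert R).

Lemma square_summable_l2 (x : l2seq K) : exists z : l2 K, forall n, z n = sval x n.
Proof.
case: x => x /= xs; apply: (@l2_mk _ _ _ (fine (\sum_(0 <= n <oo) (hnorm (x n) ^+ 2)%:E))) => N.
have e0 n : (0 <= (hnorm (x n) ^+ 2)%:E)%E by rewrite lee_fin sqr_ge0.
rewrite -lee_fin fineK; last by rewrite ge0_fin_numE // nneseries_ge0.
rewrite -sumEFin; under eq_bigr do rewrite -n2E.
exact: nneseries_lim_ge.
Qed.

Lemma trace_pairingE (p : l2seq K * l2seq K) :
  exists x y : l2 K, forall T, trace_pairing p T = pairing T x y.
Proof.
have [x xE] := square_summable_l2 p.1; have [y yE] := square_summable_l2 p.2.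
exists x, y => T; rewrite /trace_pairing /pairing; congr (limn (series _)).
by apply/funext => n; rewrite xE yE.
Qed.

Fixpoint annihilated (L : seq (l2 K * l2 K)) (T : K -> K) : Prop :=
  if L is p :: L' then pairing T p.1 p.2 = 0 /\ annihilated L' T else True.

Lemma annihilated_cat L L' T : annihilated (L ++ L') T <-> annihilated L T /\ annihilated L' T.
Proof. by elim: L => [|p L IH] /=; [tauto|rewrite IH; tauto]. Qed.

(** A functional that vanishes on the common kernel of finitely many pairings
    is a combination of them, and combinations of pairings are pairings. *)
Lemma kernel_pairing (L : seq (l2 K * l2 K)) (B : set (K -> K)) (phi : (K -> K) -> R[i]) :
  B `<=` (@bounded_op R K) ->
  (forall a S T, B S -> B T -> B (a *: S + T)) ->
  (forall a S T, B S -> B T -> phi (a *: S + T) = a * phi S + phi T) ->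
  (forall T, B T -> annihilated L T -> phi T = 0) ->
  exists x y, represents B phi x y.
Proof.
elim: L B phi => [|[u w] L IH] B phi Bbd BL pL ker.
  by exists 0, 0 => T BT; rewrite ker // pairing0 //; exact: Bbd.
have [|a S T [BS S0] [BT T0]|a S T [BS _] [BT _]|T [BT T0] LT|x [y xy]] :=
    IH [set T | B T /\ pairing T u w = 0] phi.
- by move=> T [BT _]; exact: Bbd.
- split; first exact: BL.
  by rewrite pairing_lin ?S0 ?T0 ?mulr0 ?addr0 //; exact: Bbd.
- exact: pL.
- exact: ker.
have [[T0 [BT0 pT0]]|h] := pselect (exists T0, B T0 /\ pairing T0 u w != 0); last first.
  exists x, y => T BT; apply: xy; split=> //.
  by apply/eqP; apply: contrapT => /negP hT; apply: h; exists T.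
pose c := (phi T0 - pairing T0 x y) / pairing T0 u w.
exists (interleave x (c *: u)), (interleave y w) => T BT.
rewrite pairing_interleave; last exact: Bbd.
have := pairingZ c 1 u w (Bbd _ BT); rewrite scale1r rmorph1 mulr1 => ->.
pose a := - (pairing T u w / pairing T0 u w).
have k0 : B (a *: T0 + T) /\ pairing (a *: T0 + T) u w = 0.
  split; first exact: BL.
  rewrite pairing_lin; [|exact: Bbd|exact: Bbd].
  by rewrite /a mulNr divfK // addNr.
have := xy _ k0; rewrite pL // pairing_lin; [|exact: Bbd|exact: Bbd].
rewrite /a /c => e.
have -> : phi T = (- (pairing T u w / pairing T0 u w) * phi T0 + phi T) + pairing T u w / pairing T0 u w * phi T0.
  ring.
rewrite e; by field.
Qed.

Variable B : set (K -> K).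
Hypothesis Bbd : forall T, B T -> bounded_op T.
Hypothesis B0 : B 0.
Hypothesis Blin : forall (a : R[i]) S T, B S -> B T -> B (a *: S + T).

(** The filter [F] of the common kernels of finitely many pairings converges to
    [0], so weak-star continuity makes [phi] bounded, hence zero, on one of these
    kernels. *)
Lemma weakstar_represents phi : weakstar_functional B phi -> exists x y, represents B phi x y.
Proof.
move=> [pL pC].
have p0 : phi 0 = 0.
  have := pL 1 0 0 B0 B0; rewrite scaler0 addr0 mul1r => h.
  by apply: (addrI (phi 0)); rewrite addr0 -h.
pose F : set_system (K -> K) :=
  filter_from [set: seq (l2 K * l2 K)] (fun L => [set T | B T /\ annihilated L T]).
have FF : Filter F.
  apply: filter_from_filter; first by exists [::].
  move=> L L' _ _; exists (L ++ L') => // T [BT /annihilated_cat[h h']].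
  by split.
have cF : F --> (0 : weakstar K).
  apply/cvg_sup => p A.
  rewrite nbhsE => -[U [[W Wo WU] U0] UA].
  have [x [y xy]] := trace_pairingE p.
  exists [:: (x, y)] => // T [BT [/= Txy _]]; apply: UA.
  by rewrite -WU /= xy Txy; move: U0; rewrite -WU /= xy pairing_zero.
have /subspace_continuousP := pC => /(_ 0 B0) h.
have : F [set T | B T -> normc (phi T) < 1].
  apply: cF; apply: (h [set z : R[i]^o | normc z < 1]).
  change (nbhs (phi 0 : R[i]^o) [set z : R[i]^o | normc z < 1]); rewrite p0.
  have := nbhsx_ballx (0 : R[i]^o) 1 ltr01; apply: filterS => z.
  by rewrite /ball /= sub0r normrN -normcC -ltcR.
move=> [L _ hL]; apply: (@kernel_pairing L) => // T BT LT.
have phiZ a : phi (a *: T) = a * phi T.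
  by have := pL a T 0 BT B0; rewrite p0 !addr0.
have LZ a : annihilated L (a *: T).
  elim: L {hL} LT => [//|p L IH] /= [Tp LT]; split; last exact: IH.
  by have := pairing_lin a p.1 p.2 (Bbd BT) (Bbd B0); rewrite addr0 Tp mulr0 add0r pairing_zero.
apply/eqP; apply: contrapT => /negP f0.
have BZ a : B (a *: T) by rewrite -[_ *: _]addr0; exact: Blin.
have := hL _ (conj (BZ (phi T)^-1) (LZ (phi T)^-1)) (BZ _).
by rewrite phiZ mulVf // Normc.normc1 ltxx.
Qed.

End WeakStar.

(** * Finite sums of Hilbert spaces and multipliers *)

Lemma sum_pairs (V : nmodType) (I J : finType) (f : I * J -> V) :
  \sum_p f p = \sum_i \sum_j f (i, j).
Proof. by rewrite pair_bigA; apply: eq_bigr => -[i j]. Qed.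

Section FiniteSums.
Variables (R : realType).

Lemma dot_finite_support (G : hilbert R) (s : nat) (z w : l2 G) :
  (forall n, (s <= n)%N -> w n = 0) -> '[z, w] = \sum_(a < s) '[z a, w a].
Proof.
move=> w0; have -> : w = \sum_(a < s) single a (w a).
  by rewrite -[LHS](subrK (\sum_(a < s) single a (w a))) -/(l2_tail s w)
    [l2_tail s w](_ : _ = 0) ?add0r //; apply: l2_ext => n; rewrite l2_tailE;
    case: ltnP => // /w0.
rewrite dot_sumr; apply: eq_bigr => a _; rewrite dot_single l2_sum; congr '[_, _].
by rewrite (bigD1 a) //= singleE eqxx big1 ?addr0 // => b ba; rewrite singleE;
  case: eqP => // e; case/negP: ba; apply/eqP/val_inj.
Qed.

Variable H : hilbert R.

Lemma hsumZ (I : finType) (a : R[i]) (X : hsum I H) i : (a *: X) i = a *: X i.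
Proof. by rewrite ffunE. Qed.

Lemma hsum_coord_le (I : finType) (X : hsum I H) i : hnorm (X i) <= hnorm X.
Proof.
by rewrite hnorm_le hsum_n2 (bigD1 i) //= lerDl sumr_ge0 // => j _; exact: n2_ge0.
Qed.

Lemma hsum_le_sum (I : finType) (X : hsum I H) : hnorm X <= \sum_i hnorm (X i).
Proof.
have s0 : 0 <= \sum_i hnorm (X i) by apply: sumr_ge0 => i _; exact: hnorm_ge0.
rewrite -(@ler_pXn2r _ 2) ?nnegrE ?hnorm_ge0 // n2E hsum_n2 expr2 mulr_suml.
apply: ler_sum => i _; rewrite -n2E expr2 ler_wpM2l ?hnorm_ge0 //.
by rewrite (bigD1 i) //= lerDl sumr_ge0 // => j _; exact: hnorm_ge0.
Qed.

Lemma hnorm_sum (G : hilbert R) (I : finType) (F : I -> G) :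
  hnorm (\sum_i F i) <= \sum_i hnorm (F i).
Proof.
elim: (index_enum I) => [|i r IH]; first by rewrite !big_nil hnorm0.
by rewrite !big_cons; apply: le_trans (hnorm_triangle _ _) _; rewrite lerD2l.
Qed.

Lemma hsum_bop (I J : finType) (A : I -> J -> bop H H) :
  exists C : bop (hsum J H) (hsum I H), forall X i, C X i = \sum_j A i j (X j).
Proof.
pose f (X : hsum J H) : hsum I H := [ffun i => \sum_j A i j (X j)].
have fL : linear f.
  move=> a X Y; apply/ffunP => i; rewrite !ffunE scaler_sumr -big_split.
  by apply: eq_bigr => j _; rewrite !ffunE linearP.
have /choice[C hC] : forall p : I * J, exists C : R,
    0 <= C /\ forall x, hnorm (A p.1 p.2 x) <= C * hnorm x.
  by move=> p; have [C C0 hC] := bop_bnd (A p.1 p.2); exists C.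
have fb : exists2 D : R, 0 <= D & forall X, hnorm (f X) <= D * hnorm X.
  exists (\sum_i \sum_j C (i, j)).
    by apply: sumr_ge0 => i _; apply: sumr_ge0 => j _; exact: (hC (i, j)).1.
  move=> X; apply: le_trans (hsum_le_sum _) _; rewrite mulr_suml.
  apply: ler_sum => i _; rewrite ffunE mulr_suml.
  apply: le_trans (hnorm_sum _) _; apply: ler_sum => j _.
  apply: le_trans ((hC (i, j)).2 _) _; rewrite ler_wpM2l ?hsum_coord_le //.
  exact: (hC (i, j)).1.
by exists (Bop fL fb) => X i; rewrite /= ffunE.
Qed.

Lemma coord_bop (I : finType) (i : I) : exists P : bop (hsum I H) H, forall X, P X = X i.
Proof.
apply: (bop_n2 (C := 1)) => [a X Y|X]; first by rewrite !ffunE.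
by rewrite mul1r -hnorm_le hsum_coord_le.
Qed.

Definition inj_coord (I : finType) (i : I) (h : H) : hsum I H :=
  [ffun l => if l == i then h else 0].

Lemma dot_inj_coord (I : finType) (i : I) (h : H) (X : hsum I H) :
  '[X, inj_coord i h] = '[X i, h].
Proof.
rewrite hsum_dot (bigD1 i) //= ffunE eqxx big1 ?addr0 // => l /negPf li.
by rewrite ffunE li dot0r.
Qed.

Lemma hnorm_inj_coord (I : finType) (i : I) (h : H) : hnorm (inj_coord i h) = hnorm h.
Proof.
apply/eqP; rewrite -(@eqrXn2 _ 2) ?hnorm_ge0 // !n2E.
by rewrite /n2 dot_inj_coord ffunE eqxx.
Qed.

Lemma hsum_inj_coord (I : finType) (X : hsum I H) : X = \sum_i inj_coord i (X i).
Proof.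
apply: dot_ext => Y; rewrite dot_suml hsum_dot; apply: eq_bigr => i _.
by rewrite [RHS]dotC dot_inj_coord -dotC.
Qed.

End FiniteSums.

Section Multipliers.
Variables (R : realType) (Z : Type) (Kr : Z -> Z -> R[i]) (H : rkhs Kr).

Lemma multiplier_bop T : multiplier_algebra H T -> exists A : bop H H,
  T = A /\ exists u : Z -> R[i], forall f z, '[A f, rkernel H z] = u z * '[f, rkernel H z].
Proof.
move=> [/bounded_bop[A ->] [u hu]]; exists A; split=> //; exists u => f z.
by rewrite -!reproducing hu.
Qed.

Lemma bop_multiplier (A : bop H H) (u : Z -> R[i]) :
  (forall f z, '[A f, rkernel H z] = u z * '[f, rkernel H z]) -> multiplier_algebra H A.
Proof.
move=> hu; split; first exact: bop_bounded.
by exists u => f z; rewrite !reproducing hu.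
Qed.

Lemma bounded_op_lin (G : hilbert R) (a : R[i]) (S T : G -> G) : bounded_op S -> bounded_op T ->
  bounded_op (a *: S + T).
Proof.
move=> /bounded_bop[A ->] /bounded_bop[B ->].
have L : linear (a *: (A : G -> G) + B).
  move=> b x y; rewrite -[LHS]/(a *: A (b *: x + y) + B (b *: x + y)).
  rewrite -[RHS]/(b *: (a *: A x + B x) + (a *: A y + B y)).
  rewrite (bop_lin A) (bop_lin B) !scalerDr !scalerA [b * a]mulrC.
  by rewrite addrACA.
have [C C0 hC] := bop_bnd A; have [D D0 hD] := bop_bnd B.
have b : exists2 C : R, 0 <= C & forall x : G, hnorm ((a *: (A : G -> G) + B) x) <= C * hnorm x.
  exists (normc a * C + D) => [|x]; first by rewrite addr_ge0 ?mulr_ge0 ?normc_ge0.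
  apply: le_trans (hnorm_triangle _ _) _; rewrite mulrDl lerD // hnormZ -mulrA.
  by rewrite ler_wpM2l ?normc_ge0.
exact: (bop_bounded (Bop L b)).
Qed.

Lemma multiplier_lin (a : R[i]) S T : multiplier_algebra H S -> multiplier_algebra H T ->
  multiplier_algebra H (a *: S + T).
Proof.
move=> [Sb [u hu]] [Tb [v hv]]; split; first exact: bounded_op_lin.
exists (fun z => a * u z + v z) => f z.
rewrite -[reval _ _]/(reval (a *: S f + T f) z) reval_linear hu hv; ring.
Qed.

Lemma multiplier0 : multiplier_algebra H 0.
Proof.
split.
  split; first by move=> a x y; rewrite /= scaler0 addr0.
  apply: le_lt_trans (_ : opnorm _ <= 0%:E)%E _; last by rewrite ltry.
  apply: opnorm_le => // x; by rewrite hnorm0 mul0r.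
exists (fun=> 0) => f z; by rewrite mul0r reproducing dot0l.
Qed.

Variable k : nat.

Lemma colaction_bop F : matrix_multipliers H k F -> exists C : bop (hsum 'I_k H) (hsum 'I_k H),
  colaction F = C.
Proof.
move=> hF.
have /choice[A hA] : forall p : 'I_k * 'I_k, exists A : bop H H, F p.1 p.2 = A.
  by move=> [i j]; have [A [-> _]] := multiplier_bop (hF i j); exists A.
have [C CE] := hsum_bop (fun i j => A (i, j)).
exists C; apply/funext => X; apply/ffunP => i; rewrite CE ffunE.
by apply: eq_bigr => j _; rewrite -hA.
Qed.

Lemma tensor_id_bop s F : matrix_multipliers H k F ->
  exists C : bop (hsum ('I_s * 'I_k)%type H) (hsum ('I_s * 'I_k)%type H), tensor_id F = C.
Proof.
move=> hF.
have /choice[A hA] : forall p : 'I_k * 'I_k, exists A : bop H H, F p.1 p.2 = A.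
  by move=> [i j]; have [A [-> _]] := multiplier_bop (hF i j); exists A.
have [Zo Z0] : exists Zo : bop H H, forall x, Zo x = 0.
  by apply: (bop_n2 (C := 0)) => [a x y|x]; rewrite ?scaler0 ?addr0 ?n20 ?mul0r.
have [C CE] := hsum_bop (fun p q : 'I_s * 'I_k => if p.1 == q.1 then A (p.2, q.2) else Zo).
exists C; apply/funext => X; apply/ffunP => p; rewrite CE ffunE.
rewrite sum_pairs /=.
rewrite (bigD1 p.1) //= [X in _ + X]big1 ?addr0 => [|a /negPf ap].
  by apply: eq_bigr => l _; rewrite eqxx -hA.
by rewrite big1 // => l _; rewrite eq_sym ap Z0.
Qed.

End Multipliers.

Section MultiplierOps.
Variables (R : realType) (Z : Type) (Kr : Z -> Z -> R[i]) (H : rkhs Kr) (k : nat).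
Variable Om : H.
Hypothesis Om1 : forall z, '[Om, rkernel H z] = 1.

Lemma colaction_lin (a : R[i]) (F F' : 'M[H -> H]_k) :
  colaction (\matrix_(i, j) (a *: F i j + F' i j)) = a *: colaction F + colaction F'.
Proof.
apply/funext => X; apply/ffunP => i.
rewrite -[RHS]/((a *: colaction F X + colaction F' X) i) !ffunE scaler_sumr -big_split.
by apply: eq_bigr => j _; rewrite mxE.
Qed.

Lemma tensor_id_lin s (a : R[i]) (F F' : 'M[H -> H]_k) :
  tensor_id (s := s) (\matrix_(i, j) (a *: F i j + F' i j)) = a *: tensor_id (s := s) F + tensor_id F'.
Proof.
apply/funext => X; apply/ffunP => i.
rewrite -[RHS]/((a *: tensor_id F X + tensor_id F' X) i) !ffunE scaler_sumr -big_split.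
by apply: eq_bigr => j _; rewrite mxE.
Qed.

Lemma matrix_multipliers_lin (a : R[i]) F F' : matrix_multipliers H k F ->
  matrix_multipliers H k F' -> matrix_multipliers H k (\matrix_(i, j) (a *: F i j + F' i j)).
Proof. by move=> hF hF' i j; rewrite mxE; exact: multiplier_lin. Qed.

Lemma matrix_multipliers0 : matrix_multipliers H k (\matrix_(i, j) 0).
Proof. by move=> i j; rewrite mxE; exact: multiplier0. Qed.

Lemma multiplier_ops_bounded T : multiplier_ops H k T -> bounded_op T.
Proof. by move=> [F hF <-]; have [C ->] := colaction_bop hF; exact: bop_bounded. Qed.
Lemma multiplier_ops_lin (a : R[i]) S T : multiplier_ops H k S -> multiplier_ops H k T ->
  multiplier_ops H k (a *: S + T).
Proof.
move=> [F hF <-] [F' hF' <-]; exists (\matrix_(i, j) (a *: F i j + F' i j)).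
  exact: matrix_multipliers_lin.
exact: colaction_lin.
Qed.
Lemma multiplier_ops0 : multiplier_ops H k 0.
Proof.
exists (\matrix_(i, j) 0); first exact: matrix_multipliers0.
by apply/funext => X; apply/ffunP => i; rewrite !ffunE big1 // => j _; rewrite mxE.
Qed.

Lemma amplified_ops_bounded s T : amplified_ops H k s T -> bounded_op T.
Proof. by move=> [F hF <-]; have [C ->] := tensor_id_bop s hF; exact: bop_bounded. Qed.
Lemma amplified_ops_lin s (a : R[i]) S T : amplified_ops H k s S -> amplified_ops H k s T ->
  amplified_ops H k s (a *: S + T).
Proof.
move=> [F hF <-] [F' hF' <-]; exists (\matrix_(i, j) (a *: F i j + F' i j)).
  exact: matrix_multipliers_lin.
exact: tensor_id_lin.
Qed.
Lemma amplified_ops0 s : amplified_ops H k s 0.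
Proof.
exists (\matrix_(i, j) 0); first exact: matrix_multipliers0.
by apply/funext => X; apply/ffunP => i; rewrite !ffunE big1 // => j _; rewrite mxE.
Qed.

(** The entries of [T] are multiplication operators as soon as
    [(M h)(z) = h(z) (M 1)(z)] for each of them, and these equations are
    annihilation by rank two functionals. *)
Lemma multiplier_ops_closed (T : bop (hsum 'I_k H) (hsum 'I_k H)) :
  (forall n (x y : 'I_n -> hsum 'I_k H),
    (forall S, multiplier_ops H k S -> \sum_i '[S (x i), y i] = 0) ->
    \sum_i '[T (x i), y i] = 0) -> multiplier_ops H k T.
Proof.
move=> hT.
pose F : 'M[H -> H]_k := \matrix_(i, j) (fun h => T (inj_coord j h) i).
have FE i j h : F i j h = T (inj_coord j h) i by rewrite mxE.
have injL (j : 'I_k) : linear (@inj_coord R H 'I_k j).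
  by move=> a x y; apply/ffunP => l; rewrite !ffunE; case: eqP; rewrite ?scaler0 ?addr0.
exists F.
  move=> i j.
  have FL : linear (F i j).
    by move=> a x y; rewrite !FE injL linearP !ffunE.
  have [C C0 hC] := bop_bnd T.
  have Fb : exists2 C : R, 0 <= C & forall h, hnorm (F i j h) <= C * hnorm h.
    exists C => // h; rewrite FE; apply: le_trans (hsum_coord_le _ _) _.
    by apply: le_trans (hC _) _; rewrite hnorm_inj_coord.
  apply: (@bop_multiplier _ _ _ H (Bop FL Fb) (fun z => '[F i j Om, rkernel H z])) => h z.
  pose x (n : 'I_2) := if n == ord0 then inj_coord j h else (- '[h, rkernel H z]) *: inj_coord j Om.
  pose y (n : 'I_2) := inj_coord i (rkernel H z).
  have := hT 2%N x y; rewrite !big_ord_recl big_ord0 /x /y /= addr0 => hxy.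
  change ('[F i j h, rkernel H z] = '[F i j Om, rkernel H z] * '[h, rkernel H z]).
  rewrite !FE.
  have TZ a X : T (a *: X) = a *: T X by exact: linearZ.
  apply/eqP; rewrite -subr_eq0; apply/eqP.
  move: hxy; rewrite !dot_inj_coord TZ hsumZ dotZl mulNr [in X in _ - X]mulrC => -> //.
  move=> _ [F' hF' <-]; have [A [AE [v hv]]] := multiplier_bop (hF' i j).
  have [C' CE] := colaction_bop hF'.
  have CZ a X : colaction F' (a *: X) = a *: colaction F' X.
    by rewrite CE; exact: linearZ.
  have CI g : colaction F' (inj_coord j g) i = A g.
    rewrite ffunE (bigD1 j) //= ffunE eqxx AE big1 ?addr0 // => l /negPf lj.
    by have [A' [-> _]] := multiplier_bop (hF' i l); rewrite ffunE lj linear0.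
  rewrite !big_ord_recl big_ord0 /= addr0 !dot_inj_coord CZ hsumZ !CI.
  by rewrite dotZl !hv Om1; ring.
apply/funext => X; apply/ffunP => i; rewrite ffunE [X in RHS](hsum_inj_coord X).
rewrite linear_sum sum_ffunE; apply: eq_bigr => j _; by rewrite FE.
Qed.

End MultiplierOps.

(** * The Drury-Arveson space *)

Section DA.
Variables (R : realType) (d : nat) (H : drury_arveson R d.+1).
Local Notation Z := (unit_ball R d.+1).
Local Notation kap := (rkernel H).

Let lam (v : Z) (i : 'I_d.+1) : R[i] := ((sval v 0 i)^* )%R.

Let kap_dot (v u : Z) : '[kap v, kap u] = (1 - \sum_i lam v i * (lam u i)^* %R)^-1.
Proof.
rewrite -reproducing rkernelE /da_kernel; congr (_ - _)^-1.
by apply: eq_bigr => i _; rewrite /lam conjCK mulrC.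
Qed.

(* equality would force the sum of the |v i - u i| ^+ 2 to be negative *)
Let lam1 (v u : Z) : \sum_i lam v i * (lam u i)^* %R != 1.
Proof.
apply/eqP => h.
have : 0 <= \sum_i `|sval v 0 i - sval u 0 i| ^+ 2 by apply: sumr_ge0 => i _; exact: exprn_ge0.
have -> : \sum_i `|sval v 0 i - sval u 0 i| ^+ 2 =
   \sum_i `|sval v 0 i| ^+ 2 + \sum_i `|sval u 0 i| ^+ 2 -
   (\sum_i lam v i * (lam u i)^* %R + (\sum_i lam v i * (lam u i)^* %R)^* %R).
  rewrite rmorph_sum -!big_split -sumrB; apply: eq_bigr => i _ /=.
  have -> : ((lam v i * (lam u i)^* %R)^* %R) = (lam v i)^* %R * lam u i.
    by rewrite rmorphM [X in _ * X]conjCK.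
  have cB (a b : R[i]) : ((a - b)^* = a^* - b^*)%R by exact: rmorphB.
  by rewrite /lam !normCK cB !conjCK; ring.
rewrite h rmorph1.
have v1 := svalP v; have u1 := svalP u.
have := ltrD v1 u1; rewrite -subr_lt0 => /lt_le_trans h1 /h1; by rewrite ltxx.
Qed.

Let kapT : total_family kap.
Proof.
move=> f h; apply: (@reval_inj _ _ _ H); apply/funext => v.
by rewrite !reproducing h dot0l.
Qed.

Let origin : Z.
Proof. by exists 0; rewrite big1 // => i _; rewrite mxE normr0 expr0n. Defined.

Let Om : H := kap origin.
Let kapOm v : '[kap v, Om] = 1.
Proof.
rewrite kap_dot big1 ?subr0 ?invr1 // => i _; by rewrite /lam /= mxE !rmorph0 mulr0.
Qed.
Let Omkap v : '[Om, kap v] = 1. Proof. by rewrite dotC kapOm rmorph1. Qed.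
Let Om1 : '[Om, Om] = 1. Proof. exact: kapOm. Qed.

(** The adjoints of the coordinate multipliers and their defect identity. The
    kernel satisfies [k = 1 + (\sum_i lam v i * (lam u i)^* ) k], so the vectors
    [(Om, (lam v i *: kap v)_i)] have the same Gram matrix as the [kap v]. *)
Lemma backward_shift : exists T : 'I_d.+1 -> bop H H,
  (forall i v, T i (kap v) = lam v i *: kap v) /\
  forall x y, '[x, y] = '[x, Om] * '[Om, y] + \sum_i '[T i x, T i y].
Proof.
pose W (o : option 'I_d.+1) v : H := if o is Some i then lam v i *: kap v else Om.
have [v u|A [AW Adot]] := @isometric_extension R H Z (option 'I_d.+1) kap W kapT.
  rewrite sum_option /= Om1; under eq_bigr do rewrite dotZl dotZr mulrA.
  rewrite -mulr_suml kap_dot.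
  have : 1 - \sum_i lam v i * (lam u i)^* %R != 0 by rewrite subr_eq0 eq_sym.
  move=> h; field; exact: h.
exists (fun i => A (Some i)); split=> [i v|x y]; first exact: AW.
have [D DE] := const_part_exists Om1.
have AD z : A None z = '[z, Om] *: Om.
  by rewrite -DE; apply: (total_bop kapT) => v; rewrite AW DE kapOm scale1r.
by rewrite Adot sum_option !AD dotZl dotZr Om1 mulr1 -dotC.
Qed.

Variable k : nat.
Local Notation K := (hsum 'I_k H).

Lemma cyclicP s (X : hsum ('I_s * 'I_k)%type H) :
  (forall g, (forall F, matrix_multipliers H k F -> '[g, tensor_id F X] = 0) -> g = 0) ->
  cyclic_vector X.
Proof.
move=> hX Y e e0.
pose A : set (hsum ('I_s * 'I_k)%type H) := [set tensor_id F X | F in matrix_multipliers H k].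
have AL : is_subspace A.
  split.
    exists (\matrix_(i, j) 0); first exact: matrix_multipliers0.
    by apply/ffunP => i; rewrite !ffunE big1 // => j _; rewrite mxE.
  move=> a _ _ [F hF <-] [F' hF' <-]; exists (\matrix_(i, j) (a *: F i j + F' i j)).
    exact: matrix_multipliers_lin.
  by rewrite tensor_id_lin.
have [p [Yp pA]] := projection Y AL.
have -> : Y = p.
  by apply/eqP; rewrite -subr_eq0; apply/eqP/hX => F hF; apply: Yp; exists F.
have [_ [F hF <-] h] := pA e e0; by exists F.
Qed.

(** The columns of [x] and [y] are sequences [xs j] and [ys i] over [H]; the rows
    of [X] and [Y] are the first [s] entries of [Th (xs j)] and [Th (ys i)]. The
    case [x = 0] is excluded as it gives [s = 0]. *)
Lemma factor_pairing (x y : l2 K) : x != 0 -> n2 x < 1 -> n2 y < 1 ->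
  exists s : nat, (0 < s <= k)%N /\
    exists X Y : hsum ('I_s * 'I_k)%type H,
      [/\ hnorm X < 1, hnorm Y < 1,
          forall F : 'M[H -> H]_k, matrix_multipliers H k F ->
            pairing (colaction F) x y = '[tensor_id F X, Y]
        & cyclic_vector X].
Proof.
move=> x0 x1 y1.
have [T [Tkap Tdef]] := backward_shift.
have /choice[P PE] : forall i : 'I_k, exists P : bop K H, forall X, P X = X i.
  by move=> i; exact: coord_bop.
have Pdot (u v : K) : '[u, v] = \sum_i '[P i u, P i v].
  by rewrite hsum_dot; apply: eq_bigr => i _; rewrite !PE.
have Ldot := lmap_parseval Pdot.
pose xs j := lmap (P j) x; pose ys i := lmap (P i) y.
have [s [Th [sk Thle ThM Th0 Thcyc]]] :=
  @inner_factor R d H Z T Om kap lam kapT Tkap kapOm Om1 Tdef lam1 k xs.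
have n2sum (z : l2 K) : n2 z = \sum_j n2 (lmap (P j) z).
  by rewrite /n2 Ldot raddf_sum.
exists s; split.
  rewrite sk andbT lt0n; apply: contra_neq x0 => s0; subst s.
  apply: n2_eq0; rewrite n2sum big1 // => j _.
  have Thz : Th (xs j) = 0 by apply: l2_ext => n; rewrite Th0.
  have := ThM (bid _) (fun=> 1) _ j; rewrite /= Thz linear0 => h.
  rewrite -/(xs j) h ?n20 // => g n v; by rewrite mul1r.
pose X : hsum ('I_s * 'I_k)%type H := [ffun p : 'I_s * 'I_k => Th (xs p.2) p.1].
pose Y : hsum ('I_s * 'I_k)%type H := [ffun p : 'I_s * 'I_k => Th (ys p.2) p.1].
have nXY (z : l2 K) (W : hsum ('I_s * 'I_k)%type H) : n2 z < 1 ->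
    W = [ffun p : 'I_s * 'I_k => Th (lmap (P p.2) z) p.1] -> hnorm W < 1.
  move=> z1 ->; rewrite hnorm_lt1; apply: le_lt_trans z1.
  rewrite hsum_n2 n2sum sum_pairs.
  rewrite exchange_big /=; apply: ler_sum => j _.
  apply: le_trans (Thle _).
  rewrite /n2 (dot_finite_support _ (s := s)) => [|n sn]; last by rewrite Th0.
  by rewrite raddf_sum; apply: ler_sum => a _; rewrite ffunE.
exists X, Y; split.
- exact: (nXY x).
- exact: (nXY y).
- move=> F hF; have [C CE] := colaction_bop hF.
  have /choice[A AE] : forall p : 'I_k * 'I_k, exists A : bop H H, F p.1 p.2 = A /\
     exists u : Z -> R[i], forall f z, '[A f, kap z] = u z * '[f, kap z].
    by move=> [i j]; exact: multiplier_bop (hF i j).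
  rewrite CE pairing_bop Ldot.
  have PC i : lmap (P i) (lmap C x) = \sum_j lmap (A (i, j)) (xs j).
    apply: l2_ext => n; rewrite l2_sum !lmapE PE -CE ffunE; apply: eq_bigr => j _.
    by rewrite lmapE /xs lmapE PE -(AE (i, j)).1.
  have key i j : '[lmap (A (i, j)) (xs j), ys i] = \sum_(a < s) '[A (i, j) (X (a, j)), Y (a, i)].
    have [u hu] := (AE (i, j)).2.
    rewrite (ThM (lmap (A (i, j))) u) => [|g n v]; last by rewrite !dot_single lmapE hu.
    rewrite adjPl (dot_finite_support _ (s := s)) => [|n sn]; last by rewrite Th0.
    by apply: eq_bigr => a _; rewrite !ffunE lmapE.
  rewrite hsum_dot sum_pairs.
  rewrite exchange_big /=; apply: eq_bigr => i _.
  rewrite PC; transitivity (\sum_j '[lmap (A (i, j)) (xs j), ys i]); first exact: (dot_suml (H := l2 H)).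
  rewrite (eq_bigr _ (fun j _ => key i j)) exchange_big /=.
  apply: eq_bigr => a _; rewrite [tensor_id _ _ _]ffunE; symmetry.
  apply: etrans (dot_suml (H := H) _ _ _ _) _; apply: eq_bigr => j _.
  by rewrite -(AE (i, j)).1.
- apply: cyclicP => g gX.
  (* multiplication by the monomial of the word w *)
  have multw w : exists M : bop H H, (exists u : Z -> R[i], forall f z, '[M f, kap z] = u z * '[f, kap z])
      /\ forall h f, '[h, M f] = '[word_act T w h, f].
    elim: w => [|i w [M [[u hu] hM]]].
      exists (bid H); split=> //; exists (fun=> 1) => f z; by rewrite mul1r.
    exists (bcomp (adj (T i)) M); split; last first.
      by move=> h f; rewrite -adjP hM.
    exists (fun z => (lam z i)^* %R * u z) => f z.
    by rewrite /= adjPl Tkap dotZr hu mulrA.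
  (* the i-th column of g, continued by zero *)
  pose gs i : l2 H := \sum_(a < s) single a (g (a, i)).
  have gsE i a : gs i a = if insub a is Some b then g (b, i) else 0.
    rewrite /gs l2_sum; case: insubP => [b bs eb|nas].
      rewrite (bigD1 b) //= singleE eb eqxx big1 ?addr0 // => c cb.
      by rewrite singleE -eb; case: eqP => // e; case/negP: cb; apply/eqP/val_inj.
    rewrite big1 // => b _; rewrite singleE; case: eqP => // e.
    by move: nas; rewrite e ltn_ord.
  suff gs0 i : gs i = 0.
    apply/ffunP => -[a i]; have := gsE i a; rewrite gs0 ffunE valK => <-.
    exact: l2_0.
  apply: Thcyc => [n sn|w j]; first by rewrite gsE insubN // -leqNgt.
  have [M [hu hM]] := multw w.
  pose F : 'M[H -> H]_k := \matrix_(i', j') (if (i' == i) && (j' == j) then (M : H -> H) else 0).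
  have hF : matrix_multipliers H k F.
    move=> i' j'; rewrite mxE; case: ifP => _; last exact: multiplier0.
    by have [u hu'] := hu; exact: bop_multiplier hu'.
  have := gX F hF.
  rewrite hsum_dot sum_pairs.
  have row a i' : tensor_id F X (a, i') = if i' == i then M (X (a, j)) else 0.
    rewrite ffunE (bigD1 j) //= mxE eqxx andbT big1 ?addr0 => [|l /negPf lj].
      by case: eqP.
    by rewrite mxE lj andbF.
  move=> <-; rewrite (dot_finite_support _ (s := s)) => [|n sn]; last by rewrite Th0.
  apply: eq_bigr => a _; rewrite (bigD1 i) //= row eqxx big1 ?addr0 => [|i' /negPf ii]; last first.
    by rewrite row ii dot0r.
  have TWb (z : l2 H) : word_act (fun i => lmap (T i)) w z a = word_act T w (z a).
    by elim: w z {hM multw} => [//|i' w IH] z; rewrite /word_act /= -!/(word_act _ _ _) IH lmapE.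
  by rewrite TWb hM gsE valK ffunE.
Qed.

(** A functional represented by [x = 0] is zero, and is also represented by a
    nonzero first vector and the second vector [0]. *)
Lemma factor_functional (phi : (K -> K) -> R[i]) : (0 < k)%N ->
  (exists x y : l2 K, represents (multiplier_ops H k) phi x y) ->
  (functional_norm (multiplier_ops H k) phi < 1)%E ->
  exists s : nat, (0 < s <= k)%N /\
    exists X Y : hsum ('I_s * 'I_k)%type H,
      [/\ hnorm X < 1, hnorm Y < 1,
          forall F : 'M[H -> H]_k, matrix_multipliers H k F ->
            phi (colaction F) = '[tensor_id F X, Y]
        & cyclic_vector X].
Proof.
move=> k0 [u [w uw]] phi1.
have Bbd := @multiplier_ops_bounded R Z _ H k.
have [x [y [x1 y1 xy]]] := predual_norm Bbd (multiplier_ops_closed Omkap) uw phi1.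
suff [x' [y' [x0 x'1 y'1 x'y']]] : exists x' y' : l2 K,
    [/\ x' != 0, n2 x' < 1, n2 y' < 1 & represents (multiplier_ops H k) phi x' y'].
  have [s [s0 [X [Y [X1 Y1 XY Xc]]]]] := factor_pairing x0 x'1 y'1.
  exists s; split=> //; exists X, Y; split=> // F hF.
  by rewrite -XY // x'y' //; exists F.
have [x0|x0] := eqVneq x 0; last by exists x, y.
have hOm : n2 ((2^-1 : R)%:C *: Om) = 2^-1 ^+ 2.
  by rewrite n2Z normcR ger0_norm ?invr_ge0 // /n2 Om1 /= mulr1.
pose h : K := inj_coord (Ordinal k0) ((2^-1 : R)%:C *: Om).
have nh : n2 h = 2^-1 ^+ 2 by rewrite -n2E hnorm_inj_coord n2E.
have ns : n2 (single 0%N h) = 2^-1 ^+ 2 by rewrite /n2 dot_single singleE eqxx.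
exists (single 0%N h), 0; split.
- apply/eqP => e; have := ns; rewrite e n20; lra.
- by rewrite ns; lra.
- by rewrite n20.
- move=> T BT; have [A AE] := bounded_bop (Bbd _ BT).
  rewrite xy // x0 AE !pairing_bop dot0r.
  have L0 : lmap A 0 = 0 by exact: linear0.
  by rewrite L0 dot0l.
Qed.

Definition amplify s (T : K -> K) (X : hsum ('I_s * 'I_k)%type H) :
    hsum ('I_s * 'I_k)%type H :=
  [ffun p => T [ffun l => X (p.1, l)] p.2].

Lemma amplify_colaction s F : amplify (s := s) (colaction F) = tensor_id F.
Proof.
apply/funext => X; apply/ffunP => p; rewrite !ffunE.
by apply: eq_bigr => l _; rewrite ffunE.
Qed.

Lemma amplify_n2 s (T : K -> K) X : (forall x, n2 (T x) <= n2 x) ->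
  n2 (amplify (s := s) T X) <= n2 X.
Proof.
move=> T1; rewrite !hsum_n2 !sum_pairs; apply: ler_sum => a _.
apply: le_trans (_ : n2 (T [ffun l => X (a, l)]) <= _).
  by rewrite hsum_n2; apply: ler_sum => i _; rewrite ffunE.
apply: le_trans (T1 _) _; rewrite hsum_n2; apply: ler_sum => i _.
by rewrite ffunE.
Qed.

End DA.

Section PropertyA.
Variables (R : realType) (d k : nat) (H : drury_arveson R d.+1).

(** A functional of [F (x) I_k] is the functional [phi (amplify T)] of [T], whose
    norm is not larger. The vectors that represent [phi] are sequences of
    [k * k] matrices; the shifts for [k] letters collect the rows of all these
    matrices in one sequence, which represents [phi (amplify T)]. The [s * k]
    matrices that come out of [factor_functional] are filled up with zero
    rows. *)
Theorem amplified_property_A1_1 : property_A1_1 (amplified_ops H k.+1 k.+1).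
Proof.
move=> phi phiw phi1.
set K := hsum 'I_k.+1 H; set KK := hsum ('I_k.+1 * 'I_k.+1)%type H.
have Bbd := @amplified_ops_bounded R _ _ H k.+1 k.+1.
have [x [y xy]] := weakstar_represents Bbd (@amplified_ops0 _ _ _ H k.+1 k.+1)
  (@amplified_ops_lin _ _ _ H k.+1 k.+1) phiw.
pose phi' (T : K -> K) : R[i] := phi (amplify T).
have /choice[P PE] : forall a : 'I_k.+1, exists P : bop KK K, forall X, P X = [ffun l => X (a, l)].
  move=> a; apply: (bop_n2 (C := 1)) => [c X Y|X].
    by apply/ffunP => l; rewrite !ffunE.
  rewrite mul1r !hsum_n2 sum_pairs [leRHS](bigD1 a) //= (eq_bigr (fun l => n2 (X (a, l)))) => [|l _].
    by rewrite lerDl; apply: sumr_ge0 => b _; apply: sumr_ge0 => l _; exact: n2_ge0.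
  by rewrite ffunE.
have Pdot (u v : KK) : '[u, v] = \sum_a '[P a u, P a v].
  rewrite hsum_dot sum_pairs; apply: eq_bigr => a _; rewrite !PE hsum_dot.
  by apply: eq_bigr => l _; rewrite !ffunE.
have Ldot := lmap_parseval Pdot.
pose x' : l2 K := \sum_a @fshift R k K a (lmap (P a) x).
pose y' : l2 K := \sum_a @fshift R k K a (lmap (P a) y).
have rep : represents (multiplier_ops H k.+1) phi' x' y'.
  move=> _ [F hF <-]; rewrite /phi' amplify_colaction.
  have FB : amplified_ops H k.+1 k.+1 (tensor_id F) by exists F.
  rewrite (xy _ FB); have [C CE] := colaction_bop hF; have [C' CE'] := tensor_id_bop k.+1 hF.
  rewrite CE CE' !pairing_bop Ldot /x' /y'.
  have diag a (z : l2 K) :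
      \sum_i '[fshift a z, fshift i (lmap (P i) y)] = '[z, lmap (P a) y].
    rewrite (bigD1 a) //= dot_fshiftl bshift_fshift eqxx big1 ?addr0 // => b /negPf ba.
    by rewrite dot_fshiftl bshift_fshift eq_sym ba dot0r.
  have -> : lmap C (\sum_a fshift a (lmap (P a) x)) =
      \sum_a fshift a (lmap C (lmap (P a) x)).
    by rewrite raddf_sum; apply: eq_bigr => a _; rewrite /= lmap_fshift.
  symmetry; apply: etrans (dot_suml (H := l2 K) _ _ _ _) _; apply: eq_bigr => a _.
  apply: etrans (dot_sumr (H := l2 K) _ _ _ _) _.
  apply: etrans (diag a _) _.
  congr '[_, _]; apply: l2_ext => n; rewrite !lmapE -CE -CE' !PE.
  apply/ffunP => i; rewrite !ffunE; apply: eq_bigr => l _.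
  by rewrite ffunE.
have phi'1 : (functional_norm (multiplier_ops H k.+1) phi' < 1)%E.
  apply: le_lt_trans phi1; apply: le_ereal_sup => _ [_ [[F hF <-] /= F1] <-].
  exists (tensor_id F); last by rewrite /phi' amplify_colaction.
  split; first by exists F.
  have [C CE] := colaction_bop hF; have [C' CE'] := tensor_id_bop k.+1 hF.
  apply: opnorm_le1 => X; rewrite hnorm_le -amplify_colaction; apply: amplify_n2 => z.
  rewrite -hnorm_le; apply: opnorm_le1P => //; rewrite CE; exact: bop_lin.
have [s [/andP[s0 sk] [X [Y [X1 Y1 XY _]]]]] := factor_functional (ltn0Sn k)
  (ex_intro _ x' (ex_intro _ y' rep)) phi'1.
pose pad (W : hsum ('I_s * 'I_k.+1)%type H) : KK :=
  [ffun p => if insub (val p.1) is Some a then W (a, p.2) else 0].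
have padE W (a : 'I_s) i : pad W (widen_ord sk a, i) = W (a, i).
  by rewrite ffunE /= valK.
have pad0 W (a : 'I_k.+1) i : (s <= a)%N -> pad W (a, i) = 0.
  by move=> sa; rewrite ffunE insubN // -leqNgt.
have sum_pad (V : nmodType) (f : 'I_k.+1 -> V) : (forall a : 'I_k.+1, (s <= a)%N -> f a = 0) ->
    \sum_a f a = \sum_(a < s) f (widen_ord sk a).
  move=> f0; rewrite (bigID (fun a : 'I_k.+1 => (a < s)%N)) /= [X in _ + X]big1 ?addr0.
    by rewrite big_ord_narrow.
  by move=> a; rewrite -leqNgt; exact: f0.
have pad_dot W W' : '[pad W, pad W'] = '[W, W'].
  rewrite !hsum_dot !sum_pairs sum_pad => [|a sa]; last first.
    by rewrite big1 // => i _; rewrite pad0 // dot0l.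
  by apply: eq_bigr => a _; apply: eq_bigr => i _; rewrite !padE.
have pad_n W : hnorm (pad W) = hnorm W by rewrite /hnorm /dotnorm pad_dot.
exists (pad X), (pad Y); split; rewrite ?pad_n //.
move=> _ [F hF <-]; rewrite -amplify_colaction -[LHS]/(phi' (colaction F)) XY //.
rewrite amplify_colaction -pad_dot; congr '[_, _]; apply/ffunP => -[a i].
rewrite ffunE /= ffunE; case: insubP => [b bs eb|nas].
  by rewrite ffunE; apply: eq_bigr => l _; rewrite ffunE /= -eb valK.
rewrite big1 // => l _; have [C CE] := multiplier_bop (hF i l).
by rewrite CE.1 ffunE /= insubN // linear0.
Qed.

End PropertyA.

Theorem proposition4p1 (R : realType) (d k : nat) (hd : (0 < d)%N)
    (hk : (0 < k)%N) (H : drury_arveson R d) :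
  property_A1_1 (amplified_ops H k k) /\
  forall phi : (hsum 'I_k H -> hsum 'I_k H) -> R[i],
    weakstar_functional (multiplier_ops H k) phi ->
    (functional_norm (multiplier_ops H k) phi < 1)%E ->
    exists s : nat, (0 < s <= k)%N /\
      exists X Y : hsum ('I_s * 'I_k)%type H,
        [/\ hnorm X < 1, hnorm Y < 1,
            forall F : 'M[H -> H]_k, matrix_multipliers H k F ->
              phi (colaction F) = hdot (hsum ('I_s * 'I_k)%type H) (tensor_id F X) Y
          & cyclic_vector X].
Proof.
case: d hd H => [//|d] _ H; split.
  by case: k hk => [//|k] _; exact: amplified_property_A1_1.
move=> phi phiw; apply: factor_functional => //.
exact: (weakstar_represents (@multiplier_ops_bounded _ _ _ H k)
  (@multiplier_ops0 _ _ _ H k) (@multiplier_ops_lin _ _ _ H k) phiw).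
Qed.
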